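(* Let $\beta>0$, $0<r<\pi/2$ and $0<\theta<1$. There exist positive constants $C_1$ (depending only on $\beta$ and $r$), $C_2$ (depending only on $\beta$) and $C_3$ (depending only on $\beta$ and $\theta$) with the following property. Let $0<\delta\le1$. Then for all sufficiently small $\epsilon>0$, if the real number $h>0$ and the positive integers $M$ and $N$ satisfy \[ \frac{1}{h}\ge\frac{1}{2\pi r}\,\log\frac{3C_1}{\epsilon}, \qquad M\ge\frac{1}{h}\,\log\biggl(\frac{1}{\beta}\,\log\frac{3C_2}{\epsilon}\biggr), \qquad N\ge1+\frac{1}{h}\,\log\biggl(\frac{1}{\theta\delta}\,\log\frac{3C_3}{\epsilon}\biggr), \] then \[ |\rho^N_M(t)|\le\epsilon\quad\text{for all } t \text{ with } \delta\le t\le1. \]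
   Context: For $\beta>0$, $h>0$ and $n\in\mathbb{Z}$ define \[ a_n=\exp\bigl(nh-e^{-nh}\bigr),\qquad w_n=h(1+e^{-nh})\exp\bigl(\beta(nh-e^{-nh})\bigr). \] For positive integers $M,N$ and $t>0$, the relative error of the finite exponential sum approximation $t^{-\beta}\approx\frac{1}{\Gamma(\beta)}\sum_{n=-M}^N w_ne^{-a_nt}$ is \[ \rho^N_M(t)=1-\frac{t^\beta}{\Gamma(\beta)}\sum_{n=-M}^N w_ne^{-a_nt}. \] Here $\Gamma$ is the Gamma function and $\log$ is the natural logarithm. *)

(* Defs.v *)
From Stdlib Require Import Reals ZArith.
From Coquelicot Require Import Coquelicot.
Open Scope R_scope.

(** Euler's Gamma function for [s > 0], as an improper Riemann integral over
    the open half-line: both ends are limits, since the integrand is unbounded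
    at 0 when [s < 1]. *)
Definition Gamma (s : R) : R :=
  RInt_gen (fun x : R => Rpower x (s - 1) * exp (- x))
           (at_right 0) (Rbar_locally p_infty).

Definition a_coef (h : R) (n : Z) : R :=
  exp (IZR n * h - exp (- (IZR n * h))).

Definition w_coef (beta h : R) (n : Z) : R :=
  h * (1 + exp (- (IZR n * h)))
    * exp (beta * (IZR n * h - exp (- (IZR n * h)))).

(** [sum_n u K] has the [K + 1] terms [u 0, ..., u K], so the shift
    [n = k - M] makes [n] run over the integers from [-M] to [N] inclusive. *)
Definition exp_sum (beta h : R) (M N : nat) (t : R) : R :=
  sum_n (fun k : nat =>
           let n := (Z.of_nat k - Z.of_nat M)%Z in
           w_coef beta h n * exp (- (a_coef h n * t)))
        (M + N).

Definition rel_error (beta h : R) (M N : nat) (t : R) : R :=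
  1 - Rpower t beta / Gamma beta * exp_sum beta h M N t.

(* Main.v *)
Require Import Defs.
From Stdlib Require Import Reals ZArith Lra Lia ClassicalEpsilon.
From Coquelicot Require Import Coquelicot.
Open Scope R_scope.

(** Substituting [u = t * exp (x - exp (- x))] in Euler's integral gives
    [Gamma beta = t^beta * (integral of f over the real line)] with
    [f x = (1 + exp (- x)) * exp (beta * (x - exp (- x))) * exp (- t * exp (x - exp (- x)))],
    and [exp_sum] is the trapezoidal sum of [f] with step [h], cut off to the
    nodes [- M * h, ..., N * h].  The error thus splits into the error of the
    trapezoidal rule and two truncation errors, and each is made at most
    [Gamma beta * eps / 3].

    Trapezoidal rule ([trapezoidal_rule_error]).  [f] extends to an entire
    function [F].  Weighting [f] by the [h]-periodic Poisson kernel
    [P = 1 + 2 * Re G], where [G = Q / (1 - Q)] and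
    [Q z = exp (2 * PI * i * (z + i * eta) / h)], turns the integral of [f] into
    the trapezoidal sum as [eta] tends to [0].  As [G] is holomorphic on the
    closed upper half-plane, the integral of [Re (F * G)] can be moved from the
    real line up to height [r], where [|G|] is at most [s / (1 - s)] with
    [s = exp (- 2 * PI * r / h)].  On a finite window this leaves the integrals
    along the two vertical edges; with the edges midway between nodes [|G| <= 1]
    on them, and they disappear as the window grows, since [F] decays.
    What remains is the integral of [|F (x + i r)|].  Its product with [t^beta]
    is bounded uniformly in [t <= 1] ([complex_integrand_strip_bound]): on the
    strip [|F|] is at most a constant times a function which the same kind of
    substitution turns into the density of a Gamma integral.  It is here that
    [r < PI / 2] is needed, to keep the real part of
    [exp (z - exp (- z))] positive when [x] is large.

    Truncation ([truncation_error]).  For small [eps], the function [f] increases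
    to the left of [- M * h] and decreases to the right of [N * h], so the omitted
    terms are bounded by the integrals over the tails, which are incomplete Gamma
    integrals with the bounds [u^beta / beta] for the lower one and a multiple of
    [exp (- theta * u)] for the upper one. *)

(** * Complex differentiability through real partial derivatives *)

Definition Cexp (z : C) : C := (exp (Re z) * cos (Im z), exp (Re z) * sin (Im z)).

(** Complex differentiability at a point, expressed by the Cauchy-Riemann
    equations for real partial derivatives.  Contour shifting differentiates a
    real integral in the imaginary part of the variable, and this is the form in
    which it uses holomorphy; continuity of the derivative is what allows
    differentiation under the integral sign. *)
Record holo_at (F F' : C -> C) (z : C) : Prop := {
  holo_Re_x : is_derive (fun x : R => Re (F (x, Im z))) (Re z) (Re (F' z));
  holo_Im_x : is_derive (fun x : R => Im (F (x, Im z))) (Re z) (Im (F' z));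
  holo_Re_y : is_derive (fun y : R => Re (F (Re z, y))) (Im z) (- Im (F' z));
  holo_Im_y : is_derive (fun y : R => Im (F (Re z, y))) (Im z) (Re (F' z));
  holo_cont_Re : continuous (fun w : R * R => Re (F w)) z;
  holo_cont_Im : continuous (fun w : R * R => Im (F w)) z;
  holo_cont_Re' : continuous (fun w : R * R => Re (F' w)) z;
  holo_cont_Im' : continuous (fun w : R * R => Im (F' w)) z }.

Lemma continuous_Re (z : R * R) : continuous (fun w : R * R => Re w) z.
Proof. apply continuous_fst. Qed.

Lemma continuous_Im (z : R * R) : continuous (fun w : R * R => Im w) z.
Proof. apply continuous_snd. Qed.

Lemma continuous_Rplus {U : UniformSpace} (f g : U -> R) x :
  continuous f x -> continuous g x -> continuous (fun y => f y + g y) x.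
Proof. exact (@continuous_plus U R_AbsRing R_NormedModule f g x). Qed.

Lemma continuous_Rminus {U : UniformSpace} (f g : U -> R) x :
  continuous f x -> continuous g x -> continuous (fun y => f y - g y) x.
Proof. exact (@continuous_minus U R_AbsRing R_NormedModule f g x). Qed.

Lemma continuous_Ropp {U : UniformSpace} (f : U -> R) x :
  continuous f x -> continuous (fun y => - f y) x.
Proof. exact (@continuous_opp U R_AbsRing R_NormedModule f x). Qed.

Lemma continuous_Rmult {U : UniformSpace} (f g : U -> R) x :
  continuous f x -> continuous g x -> continuous (fun y => f y * g y) x.
Proof. exact (@continuous_mult U R_AbsRing f g x). Qed.

Lemma continuous_inv_fun {U : UniformSpace} (f : U -> R) x :
  continuous f x -> f x <> 0 -> continuous (fun y => / f y) x.
Proof.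
intros Hf H0; apply (continuous_comp f Rinv); [exact Hf | now apply continuous_Rinv].
Qed.

(* Matching the goal syntactically matters: unification would read a difference
   as a sum and look for a product behind constants. *)
Ltac continuity_arith :=
  repeat first
    [ apply continuous_const
    | match goal with
      | H : continuous _ _ |- continuous _ _ => exact H
      | |- continuous (fun y => _ + _) _ => apply continuous_Rplus
      | |- continuous (fun y => _ - _) _ => apply continuous_Rminus
      | |- continuous (fun y => _ * _) _ => apply continuous_Rmult
      | |- continuous (fun y => - _) _ => apply continuous_Ropp
      end ].

Lemma is_derive_Rmult (f g : R -> R) x df dg :
  is_derive f x df -> is_derive g x dg ->
  is_derive (fun y => f y * g y) x (df * g x + f x * dg).
Proof.
intros Hf Hg; apply (@is_derive_mult R_AbsRing f g x df dg Hf Hg).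
exact Rmult_comm.
Qed.

Lemma is_derive_Rplus (f g : R -> R) x df dg :
  is_derive f x df -> is_derive g x dg ->
  is_derive (fun y => f y + g y) x (df + dg).
Proof. intros Hf Hg; exact (is_derive_plus f g x df dg Hf Hg). Qed.

Lemma is_derive_Rminus (f g : R -> R) x df dg :
  is_derive f x df -> is_derive g x dg ->
  is_derive (fun y => f y - g y) x (df - dg).
Proof. intros Hf Hg; exact (is_derive_minus f g x df dg Hf Hg). Qed.

Ltac derive_arith :=
  repeat match goal with
    | H : is_derive _ _ _ |- is_derive _ _ _ => exact H
    | |- is_derive (fun y => _ + _) _ _ => apply is_derive_Rplus
    | |- is_derive (fun y => _ - _) _ _ => apply is_derive_Rminus
    | |- is_derive (fun y => _ * _) _ _ => apply is_derive_Rmult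
    | |- is_derive (fun y => - _) _ _ => apply (is_derive_opp (V:=R_NormedModule))
    | |- is_derive (fun y => exp _) _ _ =>
        apply (is_derive_comp (K:=R_AbsRing) (V:=R_NormedModule)); [apply is_derive_exp|]
    | |- is_derive (fun y => cos _) _ _ =>
        apply (is_derive_comp (K:=R_AbsRing) (V:=R_NormedModule)); [apply is_derive_cos|]
    | |- is_derive (fun y => sin _) _ _ =>
        apply (is_derive_comp (K:=R_AbsRing) (V:=R_NormedModule)); [apply is_derive_sin|]
    | |- is_derive (fun y => / _) _ _ => apply is_derive_inv
    | |- is_derive (fun y => 1) _ _ => apply is_derive_const
    end.

Lemma is_derive_eq (f : R -> R) x l l' : is_derive f x l -> l = l' -> is_derive f x l'.
Proof. intros H E; now rewrite <- E. Qed.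

Lemma holo_id z : holo_at (fun w => w) (fun _ => RtoC 1) z.
Proof.
split; simpl;
  [auto_derive; trivial; lra .. | apply continuous_Re | apply continuous_Im
  | apply continuous_const | apply continuous_const].
Qed.

Lemma holo_const c z : holo_at (fun _ => c) (fun _ => RtoC 0) z.
Proof.
split; simpl; try (apply continuous_const); auto_derive; trivial; lra.
Qed.

Lemma holo_plus F G F' G' z : holo_at F F' z -> holo_at G G' z ->
  holo_at (fun w => F w + G w)%C (fun w => F' w + G' w)%C z.
Proof.
intros [] []; split; simpl; try (continuity_arith; fail);
  (eapply is_derive_eq; [derive_arith|]).
all: unfold Re, Im; simpl; ring.
Qed.

Lemma holo_mult F G F' G' z : holo_at F F' z -> holo_at G G' z ->
  holo_at (fun w => F w * G w)%C (fun w => F' w * G w + F w * G' w)%C z.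
Proof.
intros [] []; split; simpl; try (continuity_arith; fail);
  (eapply is_derive_eq; [derive_arith|]).
all: destruct z; unfold Re, Im; simpl; ring.
Qed.

Lemma holo_inv F F' z : holo_at F F' z -> F z <> 0 ->
  holo_at (fun w => / F w)%C (fun w => - (F' w * (/ F w * / F w)))%C z.
Proof.
intros [] H0.
assert (HN : Re (F z) ^ 2 + Im (F z) ^ 2 <> 0).
{ intros H; apply H0; apply injective_projections; simpl; unfold Re, Im in H; nra. }
assert (Hd : continuous (fun w : R * R => / (Re (F w) ^ 2 + Im (F w) ^ 2)) z).
{ apply continuous_inv_fun; [|exact HN]; simpl; continuity_arith. }
assert (Hr : continuous (fun w : R * R => Re (/ F w)) z) by (simpl; unfold Rdiv; continuity_arith).
assert (Hi : continuous (fun w : R * R => Im (/ F w)) z) by (simpl; unfold Rdiv; continuity_arith).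
split; trivial; simpl in Hr, Hi |- *; unfold Rdiv in *; try (continuity_arith; fail).
all: destruct z; eapply is_derive_eq; [derive_arith; exact HN|].
all: unfold Re, Im, opp, zero in *; simpl in *;
  match goal with |- ?a = ?b => change (@eq R a b) end; field; nra.
Qed.

Lemma holo_exp F F' z : holo_at F F' z ->
  holo_at (fun w => Cexp (F w)) (fun w => F' w * Cexp (F w))%C z.
Proof.
intros [].
assert (Hr : continuous (fun w : R * R => Re (Cexp (F w))) z).
{ simpl; apply continuous_Rmult.
  - apply (continuous_comp (fun w : R * R => Re (F w)) exp); [easy|]. apply continuous_exp.
  - apply (continuous_comp (fun w : R * R => Im (F w)) cos); [easy|]. apply continuous_cos. }
assert (Hi : continuous (fun w : R * R => Im (Cexp (F w))) z).
{ simpl; apply continuous_Rmult.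
  - apply (continuous_comp (fun w : R * R => Re (F w)) exp); [easy|]. apply continuous_exp.
  - apply (continuous_comp (fun w : R * R => Im (F w)) sin); [easy|]. apply continuous_sin. }
split; trivial; simpl in Hr, Hi |- *; unfold Rdiv in *; try (continuity_arith; fail).
all: eapply is_derive_eq; [derive_arith|].
all: destruct z; unfold Re, Im, scal in *; simpl; unfold mult; simpl; ring.
Qed.

(** * Shifting the line of integration *)

Lemma holo_continuous_Re_x F F' x y : holo_at F F' (x, y) ->
  continuous (fun u : R => Re (F (u, y))) x.
Proof. intros []; apply (ex_derive_continuous (V:=R_NormedModule)); eexists; eassumption. Qed.

Lemma locally_gt (m y : R) : m < y -> locally y (fun v : R => m < v).
Proof. intros Hy; exact (open_gt m y Hy). Qed.

(** By the Cauchy-Riemann equations the derivative in [v] of the integrand is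
    minus the [x]-derivative of [Im F], whose integral telescopes to the two
    endpoints.  This replaces Cauchy's theorem for a rectangle. *)
Lemma is_derive_horizontal_RInt F F' m a b y :
  (forall z, m < Im z -> holo_at F F' z) -> m < y ->
  is_derive (fun v : R => RInt (fun x => Re (F (x, v))) a b) y
            (Im (F (a, y)) - Im (F (b, y))).
Proof.
intros HF Hy.
assert (HD : forall x v, m < v ->
  is_derive (fun u : R => Re (F (x, u))) v (- Im (F' (x, v)))).
{ intros x v Hv; exact (holo_Re_y _ _ _ (HF (x, v) Hv)). }
assert (HV : is_RInt (fun x => - Im (F' (x, y))) a b (Im (F (a, y)) - Im (F (b, y)))).
{ replace (Im (F (a, y)) - Im (F (b, y))) with (- (Im (F (b, y)) - Im (F (a, y)))) by ring.
  apply (is_RInt_opp (V := R_NormedModule)).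
  apply (is_RInt_derive (V := R_CompleteNormedModule) (fun x => Im (F (x, y)))).
  - intros x _; exact (holo_Im_x _ _ _ (HF (x, y) Hy)).
  - intros x _.
    apply (continuous_comp_2 (fun u : R => u) (fun _ : R => y) (fun u v => Im (F' (u, v)))).
    + apply continuous_id.
    + apply continuous_const.
    + apply (continuous_ext (fun w : R * R => Im (F' w))).
      * now intros [].
      * exact (holo_cont_Im' _ _ _ (HF (x, y) Hy)). }
eapply is_derive_eq.
- apply is_derive_RInt_param.
  + generalize (locally_gt m y Hy); apply filter_imp.
    intros v Hv x _; eexists; now apply HD.
  + intros x _.
    apply (continuity_2d_pt_ext_loc (fun v u => - Im (F' (u, v)))).
    { destruct (locally_gt m y Hy) as [e He].
      exists e; intros v u Hv _; symmetry; apply is_derive_unique, HD, He, Hv. }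
    apply continuity_2d_pt_filterlim.
    apply (continuous_Ropp (fun z : R * R => Im (F' (snd z, fst z))) (y, x)).
    apply (continuous_comp_2 (fun z : R * R => snd z) (fun z : R * R => fst z)
             (fun u v => Im (F' (u, v)))).
    * apply continuous_snd.
    * apply continuous_fst.
    * apply (continuous_ext (fun w : R * R => Im (F' w))).
      { now intros []. }
      exact (holo_cont_Im' _ _ _ (HF (x, y) Hy)).
  + generalize (locally_gt m y Hy); apply filter_imp.
    intros v Hv; apply (ex_RInt_continuous (V := R_CompleteNormedModule)).
    intros x _; exact (holo_continuous_Re_x F F' x v (HF (x, v) Hv)).
- rewrite <- (is_RInt_unique _ _ _ _ HV); apply RInt_ext.
  intros x _; apply is_derive_unique, HD, Hy.
Qed.

(** The two vertical edges of the rectangle are the only obstruction to moving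
    the line of integration. *)
Lemma contour_shift F F' m a b Y B :
  (forall z, m < Im z -> holo_at F F' z) -> m < 0 -> 0 <= Y ->
  (forall y, 0 <= y <= Y -> Rabs (Im (F (a, y))) + Rabs (Im (F (b, y))) <= B) ->
  Rabs (RInt (fun x => Re (F (x, Y))) a b - RInt (fun x => Re (F (x, 0))) a b) <= B * Y.
Proof.
intros HF Hm HY HB.
pose proof (fun y Hy => is_derive_horizontal_RInt F F' m a b y HF Hy) as HD.
destruct (MVT_gen (fun v : R => RInt (fun x => Re (F (x, v))) a b) 0 Y
  (fun y => Im (F (a, y)) - Im (F (b, y)))) as [c [Hc E]].
- rewrite Rmin_left by easy; intros y Hy; apply HD; lra.
- rewrite Rmin_left by easy; intros y Hy.
  apply continuity_pt_filterlim.
  apply (ex_derive_continuous (V := R_NormedModule)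
           (fun v : R => RInt (fun x => Re (F (x, v))) a b)).
  eexists; apply (HD y); lra.
- rewrite E, Rabs_mult, (Rabs_pos_eq (Y - 0)), Rminus_0_r by lra.
  apply Rmult_le_compat_r; [easy|].
  rewrite Rmin_left, Rmax_right in Hc by easy.
  eapply Rle_trans; [apply Rabs_triang|].
  rewrite Rabs_Ropp; now apply HB.
Qed.

(** * The periodic Poisson kernel *)

Lemma Cmod_Cexp z : Cmod (Cexp z) = exp (Re z).
Proof.
unfold Cmod, Cexp; simpl.
replace (_ + _) with (exp (Re z) ^ 2 * (Rsqr (cos (Im z)) + Rsqr (sin (Im z))))
  by (unfold Rsqr; ring).
rewrite Rplus_comm, sin2_cos2, Rmult_1_r; apply sqrt_pow2, Rlt_le, exp_pos.
Qed.

Definition periodic_exp (h eta : R) (z : C) : C :=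
  Cexp (Cmult (0, 2 * PI / h) (Cplus z (0, eta))).

(** The geometric series [Q + Q^2 + Q^3 + ...] in closed form, that is, the sum
    of the positive frequencies of the kernel. *)
Definition geometric_tail (h eta : R) (z : C) : C :=
  (periodic_exp h eta z * / (1 + - 1 * periodic_exp h eta z))%C.

Definition poisson_kernel (h eta x : R) : R := 1 + 2 * Re (geometric_tail h eta (x, 0)).

(** The odd multiples of [h / 2], where [exp (2 * PI * i * a / h) = - 1]: the
    points farthest from the nodes, on which vertical edges are placed. *)
Definition half_period (h a : R) : Prop :=
  cos (2 * PI / h * a) = - 1 /\ sin (2 * PI / h * a) = 0.

Lemma half_period_half h : 0 < h -> half_period h (h / 2).
Proof.
intros Hh; unfold half_period.
replace (2 * PI / h * (h / 2)) with PI by (field; lra).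
split; [apply cos_PI | apply sin_PI].
Qed.

Lemma half_period_shift h a (n : nat) : 0 < h -> half_period h a -> half_period h (a + INR n * h).
Proof.
intros Hh [Hc Hs]; unfold half_period.
replace (2 * PI / h * (a + INR n * h)) with (2 * PI / h * a + 2 * INR n * PI) by (field; lra).
now rewrite cos_period, sin_period.
Qed.

Lemma half_period_opp h a : half_period h a -> half_period h (- a).
Proof.
intros [Hc Hs]; unfold half_period.
replace (2 * PI / h * - a) with (- (2 * PI / h * a)) by ring.
rewrite cos_neg, sin_neg; lra.
Qed.

Section Kernel.
Context (h eta : R) (Hh : 0 < h).

Local Notation s y := (exp (- (2 * PI / h * (y + eta)))).

Lemma omega_pos : 0 < 2 * PI / h.
Proof. pose proof PI_RGT_0; apply Rdiv_lt_0_compat; lra. Qed.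

Lemma decay_lt_1 y : - eta < y -> s y < 1.
Proof.
intros Hy; rewrite <- exp_0; apply exp_increasing.
pose proof (Rmult_lt_0_compat _ (y + eta) omega_pos ltac:(lra)); lra.
Qed.

Lemma periodic_expE x y :
  periodic_exp h eta (x, y) =
  (s y * cos (2 * PI / h * x), s y * sin (2 * PI / h * x)).
Proof.
unfold periodic_exp, Cexp; simpl; f_equal; f_equal; f_equal; ring.
Qed.

Lemma Cmod_periodic_exp x y : Cmod (periodic_exp h eta (x, y)) = s y.
Proof. unfold periodic_exp; rewrite Cmod_Cexp; simpl; f_equal; ring. Qed.

Lemma Cmod_one_minus_periodic_exp x y : 
  1 - s y <= Cmod (1 + - 1 * periodic_exp h eta (x, y))%C.
Proof.
pose proof (Cmod_triangle (1 + - 1 * periodic_exp h eta (x, y)) (periodic_exp h eta (x, y))) as H.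
rewrite Cmod_periodic_exp in H.
replace (1 + - 1 * periodic_exp h eta (x, y) + periodic_exp h eta (x, y))%C with (RtoC 1) in H by ring.
rewrite Cmod_1 in H; lra.
Qed.

Lemma one_minus_periodic_exp_neq0 z : - eta < Im z -> (1 + - 1 * periodic_exp h eta z)%C <> 0.
Proof.
destruct z as [x y]; simpl; intros Hy; apply Cmod_gt_0.
pose proof (Cmod_one_minus_periodic_exp x y); pose proof (decay_lt_1 y Hy); lra.
Qed.

Lemma periodic_exp_holo : exists Q', forall z, holo_at (periodic_exp h eta) Q' z.
Proof.
eexists; intros z; apply holo_exp, holo_mult; [apply holo_const|].
apply holo_plus; [apply holo_id | apply holo_const].
Qed.

Lemma geometric_tail_holo :
  exists G', forall z, - eta < Im z -> holo_at (geometric_tail h eta) G' z.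
Proof.
destruct periodic_exp_holo as [Q' HQ].
eexists; intros z Hz.
apply holo_mult; [apply HQ|].
apply holo_inv; [|now apply one_minus_periodic_exp_neq0].
apply holo_plus; [apply holo_const|].
apply holo_mult; [apply holo_const | apply HQ].
Qed.

Lemma Cmod_geometric_tail x y : - eta < y ->
  Cmod (geometric_tail h eta (x, y)) <= s y / (1 - s y).
Proof.
intros Hy; pose proof (decay_lt_1 y Hy).
unfold geometric_tail; rewrite Cmod_mult, Cmod_inv by now apply one_minus_periodic_exp_neq0.
rewrite Cmod_periodic_exp; apply Rmult_le_compat_l; [apply Rlt_le, exp_pos|].
apply Rinv_le_contravar; [lra | apply Cmod_one_minus_periodic_exp].
Qed.

(** [Q] is a negative real there, so that the tail is real and stays away
    from its poles. *)
Lemma geometric_tail_half_period a y : half_period h a ->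
  geometric_tail h eta (a, y) = RtoC (- (s y / (1 + s y))).
Proof.
intros [Hc Hs]; unfold geometric_tail; rewrite periodic_expE, Hc, Hs.
pose proof (exp_pos (- (2 * PI / h * (y + eta)))).
apply injective_projections; simpl; field; nra.
Qed.

Lemma poisson_kernelE x : - eta < 0 -> 
  poisson_kernel h eta x =
  (1 - s 0 ^ 2) / (1 - 2 * s 0 * cos (2 * PI / h * x) + s 0 ^ 2).
Proof.
intros He; unfold poisson_kernel, geometric_tail; rewrite periodic_expE.
pose proof (decay_lt_1 0 He) as H1.
pose proof (exp_pos (- (2 * PI / h * (0 + eta)))) as H0.
set (q := exp _) in *. clearbody q.
pose proof (sin2_cos2 (2 * PI / h * x)) as H2.
pose proof (COS_bound (2 * PI / h * x)) as H3.
revert H2 H3; generalize (cos (2 * PI / h * x)) (sin (2 * PI / h * x)).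
intros c d; unfold Rsqr; intros H2 H3.
assert (D : 0 < 1 - 2 * q * c + q ^ 2) by nra.
simpl.
assert (D' : (1 + (-1 * (q * c) - 0 * (q * d))) * ((1 + (-1 * (q * c) - 0 * (q * d))) * 1) +
   (0 + (-1 * (q * d) + 0 * (q * c))) * ((0 + (-1 * (q * d) + 0 * (q * c))) * 1)
   = 1 - 2 * q * c + q ^ 2).
{ transitivity (1 - 2 * q * c + q ^ 2 * (d * d + c * c)); [ring | rewrite H2; ring]. }
rewrite D'.
transitivity (1 + 2 * ((q * c - q ^ 2 * (d * d + c * c)) / (1 - 2 * q * c + q ^ 2))).
- field; lra.
- rewrite H2; field; lra.
Qed.

Lemma poisson_kernel_ge0 x : 0 < eta -> 0 <= poisson_kernel h eta x.
Proof.
intros He; rewrite poisson_kernelE by lra.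
pose proof (decay_lt_1 0 ltac:(lra)); pose proof (exp_pos (- (2 * PI / h * (0 + eta)))).
pose proof (COS_bound (2 * PI / h * x)).
apply Rmult_le_pos; [nra|]; apply Rlt_le, Rinv_0_lt_compat; nra.
Qed.

(** [1 - cos] vanishes exactly at the nodes and serves as a distance to them: the
    bound tends to [0] with [eta], so the mass of the kernel gathers at the nodes. *)
Lemma poisson_kernel_concentrates x : 0 < eta ->
  (1 - cos (2 * PI / h * x)) * poisson_kernel h eta x
  <= (exp (2 * PI / h * eta) - exp (- (2 * PI / h * eta))) / 2.
Proof.
intros He; rewrite poisson_kernelE by lra.
pose proof (decay_lt_1 0 ltac:(lra)) as H1; pose proof (exp_pos (- (2 * PI / h * (0 + eta)))) as H0.
rewrite Rplus_0_l in *.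
replace (exp (2 * PI / h * eta)) with (/ exp (- (2 * PI / h * eta)))
  by (rewrite exp_Ropp; apply Rinv_inv).
pose proof (COS_bound (2 * PI / h * x)) as H3.
set (q := exp _) in *. clearbody q.
revert H3; generalize (cos (2 * PI / h * x)); intros c H3.
assert (D : 0 < 1 - 2 * q * c + q ^ 2) by nra.
apply (Rmult_le_reg_r (1 - 2 * q * c + q ^ 2)); [easy|].
replace ((1 - c) * ((1 - q ^ 2) / (1 - 2 * q * c + q ^ 2)) * (1 - 2 * q * c + q ^ 2))
 with ((1 - c) * (1 - q ^ 2)) by (field; lra).
replace ((/ q - q) / 2 * (1 - 2 * q * c + q ^ 2))
  with ((1 - c) * (1 - q ^ 2) + (1 - q ^ 2) * (1 - q) ^ 2 / (2 * q)) by (field; lra).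
enough (0 <= (1 - q ^ 2) * (1 - q) ^ 2 / (2 * q)) by lra.
apply Rmult_le_pos; [|apply Rlt_le, Rinv_0_lt_compat; lra].
apply Rmult_le_pos; [nra | apply pow2_ge_0].
Qed.

Lemma poisson_kernel_continuous x : 0 < eta -> continuous (poisson_kernel h eta) x.
Proof.
intros He; destruct geometric_tail_holo as [G' HG].
apply (continuous_Rplus (fun _ : R => 1)); [apply continuous_const|].
apply (continuous_Rmult (fun _ : R => 2)); [apply continuous_const|].
apply (holo_continuous_Re_x _ G'), HG; simpl; lra.
Qed.

(** Over a full period the contributions of the vertical edges vanish, because
    the tail is real on them; the integral is therefore the same at all heights,
    and it is arbitrarily small at great height. *)
Lemma RInt_geometric_tail_period a : 0 < eta -> half_period h a ->
  RInt (fun x => Re (geometric_tail h eta (x, 0))) a (a + h) = 0.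
Proof.
intros He Ha.
assert (Hb : half_period h (a + h)).
{ replace (a + h) with (a + INR 1 * h) by (simpl; ring); now apply half_period_shift. }
destruct geometric_tail_holo as [G' HG].
set (J := RInt _ _ _).
set (s0 := s 0).
assert (Hs0 : s0 < 1) by (apply decay_lt_1; lra).
pose proof omega_pos as Hw.
assert (HJ : forall Y, 0 < Y -> Rabs J <= h / (2 * PI / h * (1 - s0)) / Y).
{ intros Y HY.
  assert (EY : RInt (fun x => Re (geometric_tail h eta (x, Y))) a (a + h) = J).
  { apply Rminus_diag_uniq, Rabs_eq_0, Rle_antisym; [|apply Rabs_pos].
    rewrite <- (Rmult_0_l Y).
    apply (contour_shift _ G' (- eta)); trivial; try lra.
    intros y _; rewrite !geometric_tail_half_period by easy; simpl.
    rewrite Rabs_R0; lra. }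
  rewrite <- EY.
  assert (Hc : forall x, continuous (fun x => Re (geometric_tail h eta (x, Y))) x).
  { intros x; apply (holo_continuous_Re_x _ G'), HG; simpl; lra. }
  replace (h / (2 * PI / h * (1 - s0)) / Y) with
    ((a + h - a) * (/ (2 * PI / h * Y) / (1 - s0))) by (field; pose proof PI_RGT_0; lra).
  apply (norm_RInt_le_const (V := R_NormedModule)
           (fun x => Re (geometric_tail h eta (x, Y)))); [lra| |].
  2:{ apply (RInt_correct (V := R_CompleteNormedModule)), (ex_RInt_continuous (V := R_CompleteNormedModule)); auto. }
  intros x _.
  eapply Rle_trans; [apply re_le_Cmod|].
  eapply Rle_trans; [apply Cmod_geometric_tail; lra|].
  assert (Hwy : 0 < 2 * PI / h * Y) by (apply Rmult_lt_0_compat; lra).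
  assert (HsY : s Y <= / (2 * PI / h * Y)).
  { rewrite exp_Ropp; apply Rinv_le_contravar; [easy|].
    pose proof (exp_ineq1_le (2 * PI / h * (Y + eta))).
    pose proof (Rmult_lt_0_compat _ _ Hw He); lra. }
  assert (HsY0 : s Y <= s0).
  { unfold s0; apply Rlt_le, exp_increasing.
    pose proof (Rmult_lt_0_compat _ _ Hw HY); lra. }
  apply Rmult_le_compat; trivial.
  - apply Rlt_le, exp_pos.
  - apply Rlt_le, Rinv_0_lt_compat; lra.
  - apply Rinv_le_contravar; lra. }
destruct (Req_dec J 0) as [|HJ0]; [easy|exfalso].
apply Rabs_pos_lt in HJ0.
set (A := h / (2 * PI / h * (1 - s0))) in *.
assert (HA : 0 < A).
{ apply Rdiv_lt_0_compat; [easy|]; apply Rmult_lt_0_compat; lra. }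
assert (HY : 0 < 2 * A / Rabs J) by (apply Rdiv_lt_0_compat; lra).
specialize (HJ _ HY).
replace (A / (2 * A / Rabs J)) with (Rabs J / 2) in HJ by (field; lra); lra.
Qed.

Lemma RInt_poisson_kernel_period a : 0 < eta -> half_period h a ->
  RInt (poisson_kernel h eta) a (a + h) = h.
Proof.
intros He Ha; destruct geometric_tail_holo as [G' HG].
assert (Hc : forall x, continuous (fun x => Re (geometric_tail h eta (x, 0))) x).
{ intros x; apply (holo_continuous_Re_x _ G'), HG; simpl; lra. }
assert (Hi : ex_RInt (fun x => Re (geometric_tail h eta (x, 0))) a (a + h)).
{ apply (ex_RInt_continuous (V := R_CompleteNormedModule)); auto. }
unfold poisson_kernel.
rewrite (RInt_plus (V := R_CompleteNormedModule) (fun _ => 1)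
           (fun x => 2 * Re (geometric_tail h eta (x, 0)))).
- rewrite (RInt_scal (V := R_CompleteNormedModule) (fun x => Re (geometric_tail h eta (x, 0)))) by easy.
  rewrite RInt_geometric_tail_period by easy.
  rewrite RInt_const; unfold plus, scal; simpl; unfold mult; simpl; ring.
- apply ex_RInt_const.
- now apply (ex_RInt_scal (V := R_CompleteNormedModule)).
Qed.
End Kernel.

(** * The kernel approximates the trapezoidal sum *)

Lemma ex_RInt_cont (f : R -> R) a b : (forall x, continuous f x) -> ex_RInt f a b.
Proof. intros Hf; apply (ex_RInt_continuous (V := R_CompleteNormedModule)); auto. Qed.

(** Near [c] continuity gives [e]; away from [c], but within half a period,
    [1 - cos] is bounded below and a large [K] absorbs the bound on [f]. *)
Lemma continuous_deviation_bound (f : R -> R) h c e : 0 < h -> 0 < e ->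
  (forall x, continuous f x) ->
  exists K, 0 <= K /\ forall x, c - h / 2 <= x <= c + h / 2 ->
    Rabs (f x - f c) <= e + K * (1 - cos (2 * PI / h * (x - c))).
Proof.
intros Hh He Hf.
pose proof (omega_pos h Hh) as Hw.
assert (Hc : forall x, continuous (fun y => Rabs (f y - f c)) x).
{ intros x; apply (continuous_comp (fun y => f y - f c) Rabs).
  - apply continuous_Rminus; [apply Hf | apply continuous_const].
  - apply continuous_Rabs. }
destruct (continuity_ab_maj (fun y => Rabs (f y - f c)) (c - h / 2) (c + h / 2))
  as [xm [HB _]]; [lra| |].
{ intros x _; apply continuity_pt_filterlim, Hc. }
set (B := Rabs (f xm - f c)) in *.
assert (HB0 : 0 <= B) by apply Rabs_pos.
destruct (proj1 (filterlim_locally (F := locally c) f (f c)) (Hf c) (mkposreal e He)) as [d Hd].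
set (d' := Rmin d (h / 2)).
assert (Hd'0 : 0 < d') by (apply Rmin_pos; [apply cond_pos | lra]).
assert (Hd'1 : d' <= d) by apply Rmin_l.
assert (Hd'2 : d' <= h / 2) by apply Rmin_r.
assert (Hpi : 2 * PI / h * (h / 2) = PI) by (field; lra).
assert (Hwd : 0 < 2 * PI / h * d' <= PI).
{ split; [now apply Rmult_lt_0_compat|]; apply Rle_trans with (2 * PI / h * (h / 2)); [apply Rmult_le_compat_l|]; lra. }
assert (Hcos : cos (2 * PI / h * d') < 1).
{ rewrite <- cos_0; apply cos_decreasing_1; lra. }
exists (B / (1 - cos (2 * PI / h * d'))); split.
{ apply Rdiv_le_0_compat; lra. }
intros x Hx.
set (K := B / _).
assert (HK : 0 <= K) by (apply Rdiv_le_0_compat; lra).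
pose proof (COS_bound (2 * PI / h * (x - c))).
destruct (Rlt_or_le (Rabs (x - c)) d') as [Hl|Hl].
- assert (Rabs (f x - f c) < e) by (apply (Hd x); change (Rabs (x - c) < d); lra).
  assert (0 <= K * (1 - cos (2 * PI / h * (x - c)))) by (apply Rmult_le_pos; lra).
  lra.
- assert (E : cos (2 * PI / h * (x - c)) = cos (2 * PI / h * Rabs (x - c))).
  { unfold Rabs; destruct (Rcase_abs _); [|easy].
    rewrite <- cos_neg; f_equal; ring. }
  assert (Hle : cos (2 * PI / h * (x - c)) <= cos (2 * PI / h * d')).
  { rewrite E; apply cos_decr_1; try lra.
    - apply Rmult_le_pos; [lra | apply Rabs_pos].
    - apply Rle_trans with (2 * PI / h * (h / 2)); [|lra].
      apply Rmult_le_compat_l; [lra|]; apply Rabs_le; lra.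
    - apply Rmult_le_compat_l; lra. }
  apply Rle_trans with B; [apply HB, Hx|].
  replace B with (K * (1 - cos (2 * PI / h * d'))) by (unfold K; field; lra).
  assert (K * (1 - cos (2 * PI / h * d')) <= K * (1 - cos (2 * PI / h * (x - c))))
    by (apply Rmult_le_compat_l; lra).
  lra.
Qed.

(** As the kernel has total mass [h] on the cell, the difference is the integral
    of [f x - f c] against it, [c] being the node in the middle; the deviation
    bound splits this into a multiple of the mass and a multiple of the
    concentration bound. *)
Lemma poisson_kernel_approximates_cell (f : R -> R) h a e : 0 < h -> 0 < e ->
  half_period h a -> (forall x, continuous f x) ->
  exists eta0, 0 < eta0 /\ forall eta, 0 < eta < eta0 ->
    Rabs (RInt (fun x => f x * poisson_kernel h eta x) a (a + h) - h * f (a + h / 2)) <= e.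
Proof.
intros Hh He Ha Hf.
set (c := a + h / 2).
destruct (continuous_deviation_bound f h c (e / (2 * h)) Hh) as [K [HK HfK]]; trivial.
{ apply Rdiv_lt_0_compat; lra. }
set (sh := fun eta => (exp (2 * PI / h * eta) - exp (- (2 * PI / h * eta))) / 2).
assert (Hsh : continuous sh 0).
{ apply (ex_derive_continuous (V := R_NormedModule)); unfold sh; auto_derive; lra. }
assert (Hd : 0 < e / (2 * h * (K + 1))).
{ apply Rdiv_lt_0_compat; [easy|]; apply Rmult_lt_0_compat; lra. }
destruct (proj1 (filterlim_locally (F := locally 0) sh (sh 0)) Hsh (mkposreal _ Hd)) as [d Hd'].
exists d; split; [apply cond_pos|]; intros eta Heta.
assert (Hs : sh eta < e / (2 * h * (K + 1))).
{ assert (Hb : Rabs (sh eta - sh 0) < e / (2 * h * (K + 1))).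
  { apply (Hd' eta); change (Rabs (eta - 0) < d); rewrite Rabs_pos_eq; lra. }
  unfold sh at 2 in Hb; rewrite Rmult_0_r, Ropp_0, exp_0 in Hb.
  apply Rabs_def2 in Hb; lra. }
pose (P := poisson_kernel h eta).
assert (HP : forall x, continuous P x) by (intros x; apply poisson_kernel_continuous; lra).
assert (HPint : RInt P a (a + h) = h) by (apply RInt_poisson_kernel_period; trivial; lra).
change (poisson_kernel h eta) with P.
assert (E : RInt (fun x => f x * P x) a (a + h) - h * f c
          = RInt (fun x => (f x - f c) * P x) a (a + h)).
{ rewrite (RInt_ext (fun x => (f x - f c) * P x) (fun x => f x * P x - f c * P x))
    by (intros x _; apply Rmult_minus_distr_r).
  rewrite (RInt_minus (V := R_CompleteNormedModule) (fun x => f x * P x) (fun x => f c * P x)).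
  - rewrite (RInt_scal (V := R_CompleteNormedModule) P) by now apply ex_RInt_cont.
    rewrite HPint; unfold minus, plus, opp, scal; simpl; unfold mult; simpl; ring.
  - apply ex_RInt_cont; intros x; now apply continuous_Rmult.
  - apply ex_RInt_cont; intros x; apply continuous_Rmult; trivial; apply continuous_const. }
rewrite E.
assert (HfP : forall x, continuous (fun x => (f x - f c) * P x) x).
{ intros x; apply continuous_Rmult; trivial; apply continuous_Rminus; trivial; apply continuous_const. }
set (b := e / (2 * h)) in *.
eapply Rle_trans; [apply abs_RInt_le; [lra | now apply ex_RInt_cont]|].
apply Rle_trans with (RInt (fun x => b * P x + K * sh eta) a (a + h)).
- apply RInt_le; [lra | | |].
  + apply ex_RInt_cont; intros x.
    apply (continuous_comp (fun x => (f x - f c) * P x) Rabs); trivial; apply continuous_Rabs.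
  + apply ex_RInt_cont; intros x; continuity_arith; trivial.
  + intros x Hx.
    assert (HP0 : 0 <= P x) by (apply poisson_kernel_ge0; lra).
    rewrite Rabs_mult, (Rabs_pos_eq (P x)) by easy.
    assert (Ec : cos (2 * PI / h * (x - c)) = cos (2 * PI / h * x)).
    { destruct Ha as [Ha1 Ha2].
      replace (2 * PI / h * (x - c)) with (2 * PI / h * x - 2 * PI / h * a - PI)
        by (unfold c; field; lra).
      rewrite cos_minus, cos_PI, sin_PI, cos_minus, Ha1, Ha2; ring. }
    apply Rle_trans with ((b + K * (1 - cos (2 * PI / h * x))) * P x).
    * apply Rmult_le_compat_r; trivial.
      rewrite <- Ec; apply HfK; unfold c; lra.
    * assert (K * ((1 - cos (2 * PI / h * x)) * P x) <= K * sh eta).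
      { apply Rmult_le_compat_l; trivial; apply poisson_kernel_concentrates; lra. }
      lra.
- rewrite (RInt_plus (V := R_CompleteNormedModule) (fun x => b * P x) (fun _ => K * sh eta)).
  + rewrite (RInt_scal (V := R_CompleteNormedModule) P) by now apply ex_RInt_cont.
    rewrite HPint, RInt_const; unfold plus, scal; simpl; unfold mult; simpl.
    assert (K * sh eta <= K * (e / (2 * h * (K + 1)))) by (apply Rmult_le_compat_l; lra).
    assert (h * (K * (e / (2 * h * (K + 1)))) <= e / 2).
    { replace (h * (K * (e / (2 * h * (K + 1))))) with (e / 2 - e / 2 / (K + 1)) by (field; lra).
      assert (0 <= e / 2 / (K + 1)) by (apply Rdiv_le_0_compat; lra). lra. }
    replace (b * h) with (e / 2) by (unfold b; field; lra).
    replace (a + h - a) with h by ring.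
    assert (h * (K * sh eta) <= h * (K * (e / (2 * h * (K + 1))))) by (apply Rmult_le_compat_l; lra).
    lra.
  + apply ex_RInt_cont; intros x; apply continuous_Rmult; trivial; apply continuous_const.
  + apply ex_RInt_const.
Qed.

Lemma poisson_kernel_approximates_sum (f : R -> R) h a n e : 0 < h -> 0 < e ->
  half_period h a -> (forall x, continuous f x) ->
  exists eta0, 0 < eta0 /\ forall eta, 0 < eta < eta0 ->
    Rabs (RInt (fun x => f x * poisson_kernel h eta x) a (a + INR (S n) * h)
          - sum_n (fun k => h * f (a + (INR k + / 2) * h)) n) <= e.
Proof.
intros Hh He0 Ha Hf; revert e He0; induction n as [|n IH]; intros e He.
- destruct (poisson_kernel_approximates_cell f h a e) as [eta0 [H0 H1]]; trivial.
  exists eta0; split; trivial; intros eta Heta.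
  rewrite sum_O; simpl.
  replace (a + 1 * h) with (a + h) by ring.
  replace (a + (0 + / 2) * h) with (a + h / 2) by field.
  now apply H1.
- destruct (IH (e / 2)) as [eta1 [H0 H1]]; [lra|].
  destruct (poisson_kernel_approximates_cell f h (a + INR (S n) * h) (e / 2)) as [eta2 [H2 H3]];
    trivial; [lra | now apply half_period_shift|].
  exists (Rmin eta1 eta2); split; [now apply Rmin_pos|]; intros eta Heta.
  pose proof (Rmin_l eta1 eta2); pose proof (Rmin_r eta1 eta2).
  assert (HI : forall u v, ex_RInt (fun x => f x * poisson_kernel h eta x) u v).
  { intros u v; apply ex_RInt_cont; intros x; apply continuous_Rmult; trivial.
    apply poisson_kernel_continuous; lra. }
  rewrite sum_Sn.
  rewrite <- (RInt_Chasles (V := R_CompleteNormedModule) _ a (a + INR (S n) * h)) by apply HI.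
  specialize (H1 eta ltac:(lra)); specialize (H3 eta ltac:(lra)).
  replace (a + INR (S n) * h + h) with (a + INR (S (S n)) * h) in H3
    by (rewrite (S_INR (S n)); ring).
  replace (a + INR (S n) * h + h / 2) with (a + (INR (S n) + / 2) * h) in H3 by field.
  apply Rabs_le; apply Rabs_le_between in H1; apply Rabs_le_between in H3.
  unfold plus; simpl in *; lra.
Qed.

(** * The trapezoidal rule *)

Lemma Rabs_Im_le_Cmod z : Rabs (Im z) <= Cmod z.
Proof. destruct z as [x y]; eapply Rle_trans; [apply Rmax_r | apply (Rmax_Cmod (x, y))]. Qed.

(** The window ends half a step beyond the extreme nodes, so that every node is
    in the middle of a cell and the vertical edges avoid the poles of the kernel.
    The term with [B] comes from these edges, the other one from the line at
    height [r]. *)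
Lemma trapezoidal_rule_error (F F' : C -> C) (f k : R -> R) (h r B : R) (M N : nat) :
  let a := - ((INR M + / 2) * h) in
  let b := (INR N + / 2) * h in
  let s := exp (- (2 * PI * r / h)) in
  0 < h -> 0 < r ->
  (forall z, holo_at F F' z) ->
  (forall x, F (x, 0) = RtoC (f x)) ->
  (forall x, continuous k x) -> (forall x, Cmod (F (x, r)) <= k x) ->
  (forall y, 0 <= y <= r -> Cmod (F (a, y)) + Cmod (F (b, y)) <= B) ->
  Rabs (sum_n (fun j => h * f (IZR (Z.of_nat j - Z.of_nat M) * h)) (M + N) - RInt f a b)
  <= 2 * (s / (1 - s)) * RInt k a b + 2 * B * r.
Proof.
intros a b s Hh Hr HF Hf Hk HFk HB.
assert (Hab : a <= b).
{ pose proof (pos_INR M); pose proof (pos_INR N).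
  assert (0 <= (INR M + / 2) * h /\ 0 <= (INR N + / 2) * h) by (split; apply Rmult_le_pos; lra).
  unfold a, b; lra. }
assert (Ea : a = - (h / 2 + INR M * h)) by (unfold a; field).
assert (Ha : half_period h a).
{ rewrite Ea; now apply half_period_opp, half_period_shift, half_period_half. }
assert (Hb : half_period h b).
{ replace b with (h / 2 + INR N * h) by (unfold b; field).
  now apply half_period_shift, half_period_half. }
assert (Hfc : forall x, continuous f x).
{ intros x; apply (continuous_ext (fun x => Re (F (x, 0)))).
  - intros u; now rewrite Hf.
  - apply (holo_continuous_Re_x F F'), HF. }
assert (Hs : 0 < s < 1).
{ split; [apply exp_pos|]; unfold s; rewrite <- exp_0; apply exp_increasing.
  assert (0 < 2 * PI * r / h); [|lra].
  pose proof PI_RGT_0; apply Rdiv_lt_0_compat; [|easy]; apply Rmult_lt_0_compat; lra. }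
apply le_epsilon; intros e He.
destruct (poisson_kernel_approximates_sum f h a (M + N) e) as [eta0 [He0 Happ]]; trivial.
specialize (Happ (eta0 / 2) ltac:(lra)).
set (eta := eta0 / 2) in *.
assert (Heta : 0 < eta) by (unfold eta; lra).
replace (a + INR (S (M + N)) * h) with b in Happ
  by (unfold a, b; rewrite S_INR, plus_INR; field).
replace (sum_n (fun k => h * f (a + (INR k + / 2) * h)) (M + N))
  with (sum_n (fun j => h * f (IZR (Z.of_nat j - Z.of_nat M) * h)) (M + N)) in Happ.
2:{ apply sum_n_ext; intros j; do 2 f_equal.
    rewrite minus_IZR, <- !INR_IZR_INZ; unfold a; field. }
set (S := sum_n _ _) in *.
destruct (geometric_tail_holo h eta Hh) as [G' HG].
set (G := geometric_tail h eta) in *.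
pose (H := fun z => (F z * G z)%C).
assert (HH : exists H', forall z, - eta < Im z -> holo_at H H' z).
{ eexists; intros z Hz; apply holo_mult; [apply HF | now apply HG]. }
destruct HH as [H' HH].
assert (Hc : forall y, - eta < y -> forall x, continuous (fun u : R => Re (H (u, y))) x).
{ intros y Hy x; now apply (holo_continuous_Re_x H H'), HH. }
assert (HG1 : forall u y, half_period h u -> 0 <= y -> Cmod (G (u, y)) <= 1).
{ intros u y Hu Hy; unfold G; rewrite geometric_tail_half_period by easy.
  rewrite Cmod_R, Rabs_Ropp.
  pose proof (exp_pos (- (2 * PI / h * (y + eta)))) as H0; set (q := exp _) in *.
  rewrite Rabs_pos_eq by (apply Rdiv_le_0_compat; lra).
  apply Rle_div_l; lra. }
assert (E : RInt (fun x => f x * poisson_kernel h eta x) a b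
            = RInt f a b + 2 * RInt (fun x => Re (H (x, 0))) a b).
{ rewrite (RInt_ext _ (fun x => f x + 2 * Re (H (x, 0)))).
  - rewrite (RInt_plus (V := R_CompleteNormedModule) f (fun x => 2 * Re (H (x, 0)))).
    + rewrite (RInt_scal (V := R_CompleteNormedModule) (fun x => Re (H (x, 0)))); [easy|].
      apply ex_RInt_cont, Hc; lra.
    + now apply ex_RInt_cont.
    + apply ex_RInt_cont; intros x; apply continuous_Rmult; [apply continuous_const | apply Hc; lra].
  - intros x _; unfold H, poisson_kernel; fold G; rewrite Hf; simpl.
    change (@eq R (f x * (1 + 2 * Re (G (x, 0)))) (f x + 2 * (f x * Re (G (x, 0)) - 0 * Im (G (x, 0))))).
    ring. }
assert (Hshift : Rabs (RInt (fun x => Re (H (x, r))) a b - RInt (fun x => Re (H (x, 0))) a b) <= B * r).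
{ apply (contour_shift H H' (- eta)); trivial; try lra.
  intros y Hy; eapply Rle_trans; [|apply (HB y Hy)].
  assert (HI : forall u, half_period h u -> Rabs (Im (H (u, y))) <= Cmod (F (u, y))).
  { intros u Hu; eapply Rle_trans; [apply Rabs_Im_le_Cmod|].
    unfold H; rewrite Cmod_mult; rewrite <- (Rmult_1_r (Cmod (F (u, y)))) at 2.
    apply Rmult_le_compat_l; [apply Cmod_ge_0 | apply HG1; lra || easy]. }
  apply Rplus_le_compat; now apply HI. }
assert (Htop : Rabs (RInt (fun x => Re (H (x, r))) a b) <= s / (1 - s) * RInt k a b).
{ eapply Rle_trans; [apply abs_RInt_le; [easy | apply ex_RInt_cont, Hc; lra]|].
  rewrite <- (RInt_scal (V := R_CompleteNormedModule) k) by now apply ex_RInt_cont.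
  apply RInt_le; [easy | | |].
  - apply ex_RInt_cont; intros x.
    apply (continuous_comp (fun x => Re (H (x, r))) Rabs); [apply Hc; lra | apply continuous_Rabs].
  - apply ex_RInt_cont; intros x; apply continuous_Rmult; [apply continuous_const | apply Hk].
  - intros x _; eapply Rle_trans; [apply re_le_Cmod|].
    unfold H; rewrite Cmod_mult, Rmult_comm.
    apply Rmult_le_compat; try apply Cmod_ge_0; [|apply HFk].
    eapply Rle_trans; [apply Cmod_geometric_tail; lra|].
    set (q := exp _).
    assert (Hq : q <= s).
    { unfold q, s; apply Rlt_le, exp_increasing.
      pose proof (Rmult_lt_0_compat _ _ (omega_pos h Hh) Heta).
      replace (2 * PI * r / h) with (2 * PI / h * r) by (field; lra); lra. }
    apply Rmult_le_compat; try lra.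
    + apply Rlt_le, exp_pos.
    + apply Rlt_le, Rinv_0_lt_compat; lra.
    + apply Rinv_le_contravar; lra. }
rewrite E in Happ.
apply Rabs_le; apply Rabs_le_between in Happ; apply Rabs_le_between in Hshift;
  apply Rabs_le_between in Htop; lra.
Qed.

(** * Incomplete Gamma integrals *)

Lemma exp_monotone x y : x <= y -> exp x <= exp y.
Proof. intros [H|H]; [now apply Rlt_le, exp_increasing | rewrite H; apply Rle_refl]. Qed.

Definition gamma_density (beta kappa u : R) : R := Rpower u (beta - 1) * exp (- (kappa * u)).

(** The maximum of the left-hand side is at [u = a / k]; the weaker bound without
    the factor [exp (- a)] needs only [ln v <= v]. *)
Lemma Rpower_exp_bound a k u : 0 < a -> 0 < k -> 0 < u ->
  Rpower u a * exp (- (k * u)) <= Rpower (a / k) a.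
Proof.
intros Ha Hk Hu; unfold Rpower; rewrite <- exp_plus; apply exp_monotone.
assert (Hak : 0 < a / k) by now apply Rdiv_lt_0_compat.
assert (Hln : ln (u / (a / k)) <= u / (a / k)).
{ assert (H0 : 0 < u / (a / k)) by now apply Rdiv_lt_0_compat.
  pose proof (exp_ineq1_le (ln (u / (a / k)))) as H; rewrite exp_ln in H by easy; lra. }
rewrite ln_div in Hln by easy.
apply (Rmult_le_compat_l a) in Hln; [|lra].
replace (a * (u / (a / k))) with (k * u) in Hln by (field; lra).
lra.
Qed.

Lemma is_derive_Rpower a u : 0 < u -> is_derive (fun v => Rpower v a) u (a * Rpower u (a - 1)).
Proof. intros Hu; apply is_derive_Reals; now apply derivable_pt_lim_power. Qed.

Lemma continuous_Rpower a u : 0 < u -> continuous (fun v => Rpower v a) u.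
Proof.
intros Hu; apply (ex_derive_continuous (V := R_NormedModule)).
eexists; now apply is_derive_Rpower.
Qed.

Lemma gamma_density_continuous beta kappa u : 0 < u -> continuous (gamma_density beta kappa) u.
Proof.
intros Hu; apply continuous_Rmult; [now apply continuous_Rpower|].
apply (ex_derive_continuous (V := R_NormedModule) (fun u => exp (- (kappa * u)))); auto_derive; trivial.
Qed.

Lemma gamma_density_gt0 beta kappa u : 0 < gamma_density beta kappa u.
Proof. apply Rmult_lt_0_compat; apply exp_pos. Qed.

Lemma ex_RInt_positive_axis (f : R -> R) A B : 0 < A -> 0 < B ->
  (forall u, 0 < u -> continuous f u) -> ex_RInt f A B.
Proof.
intros HA HB Hf; apply (ex_RInt_continuous (V := R_CompleteNormedModule)).
intros u Hu; apply Hf; pose proof (Rmin_pos A B HA HB); lra.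
Qed.

Lemma ex_RInt_gamma_density beta kappa A B : 0 < A -> 0 < B ->
  ex_RInt (gamma_density beta kappa) A B.
Proof. intros HA HB; apply ex_RInt_positive_axis; trivial; apply gamma_density_continuous. Qed.

(** The density is at most a multiple of the derivative of [- 1 / (1 + u^beta)],
    a bounded function on the whole half-line; this handles both ends at once. *)
Lemma RInt_gamma_density_bounded beta kappa : 0 < beta -> 0 < kappa ->
  exists K, 0 < K /\ forall A B, 0 < A <= B -> RInt (gamma_density beta kappa) A B <= K.
Proof.
intros Hb Hk.
(* [(1 + v)^2 <= 2 + 2 * v^2] with [v = u^beta], damped by [exp (- kappa * u)]. *)
set (K1 := 2 + 2 * Rpower (2 * beta / kappa) (2 * beta)).
assert (HK1 : 0 < K1) by (pose proof (exp_pos (2 * beta * ln (2 * beta / kappa))); unfold K1, Rpower; lra).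
exists (K1 / beta); split; [now apply Rdiv_lt_0_compat|].
intros A B [HA HAB].
set (g := fun u => - / (1 + Rpower u beta)).
set (dg := fun u => beta * Rpower u (beta - 1) / (1 + Rpower u beta) ^ 2).
assert (Hpos : forall u, 0 < Rpower u beta) by (intros u; apply exp_pos).
assert (Hg : forall u, 0 < u -> is_derive g u (dg u)).
{ intros u Hu; unfold g, dg; specialize (Hpos u).
  eapply is_derive_eq.
  - apply (is_derive_opp (V := R_NormedModule)), is_derive_inv; [|lra].
    apply is_derive_Rplus; [apply is_derive_const | now apply is_derive_Rpower].
  - unfold opp, zero; simpl.
    match goal with |- ?a = ?b => change (@eq R a b) end; field; lra. }
assert (Hdg : forall u, 0 < u -> continuous dg u).
{ intros u Hu; unfold dg, Rdiv; specialize (Hpos u); apply continuous_Rmult.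
  - apply continuous_Rmult; [apply continuous_const | now apply continuous_Rpower].
  - apply (continuous_inv_fun (fun v => (1 + Rpower v beta) ^ 2)); [|apply pow_nonzero; lra].
    simpl; continuity_arith; now apply continuous_Rpower. }
assert (HI : is_RInt dg A B (g B - g A)).
{ apply (is_RInt_derive (V := R_CompleteNormedModule)); intros u Hu;
    rewrite Rmin_left in Hu by easy; [apply Hg | apply Hdg]; lra. }
apply Rle_trans with (RInt (fun u => K1 / beta * dg u) A B).
- apply RInt_le; trivial; [apply ex_RInt_gamma_density; lra | |].
  + apply ex_RInt_positive_axis; try lra; intros u Hu.
    apply continuous_Rmult; [apply continuous_const | now apply Hdg].
  + intros u Hu; unfold gamma_density, dg; specialize (Hpos u).
    pose proof (Rpower_exp_bound (2 * beta) kappa u ltac:(lra) Hk ltac:(lra)) as H2.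
    assert (E2 : Rpower u (2 * beta) = Rpower u beta ^ 2).
    { replace (2 * beta) with (beta + beta) by ring; rewrite Rpower_plus; ring. }
    rewrite E2 in H2.
    assert (He : exp (- (kappa * u)) <= 1).
    { rewrite <- exp_0; apply exp_monotone; pose proof (Rmult_lt_0_compat kappa u Hk ltac:(lra)); lra. }
    pose proof (exp_pos (- (kappa * u))).
    assert (H1 : (1 + Rpower u beta) ^ 2 * exp (- (kappa * u)) <= K1).
    { assert (0 <= (1 - Rpower u beta) ^ 2 * exp (- (kappa * u)))
        by (apply Rmult_le_pos; [apply pow2_ge_0 | lra]).
      unfold K1; nra. }
    replace (K1 / beta * (beta * Rpower u (beta - 1) / (1 + Rpower u beta) ^ 2))
      with (Rpower u (beta - 1) * (K1 / (1 + Rpower u beta) ^ 2)) by (field; lra).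
    apply Rmult_le_compat_l; [apply Rlt_le, exp_pos|].
    apply Rle_div_r; [nra | lra].
- rewrite (RInt_scal (V := R_CompleteNormedModule) dg) by (eexists; exact HI).
  rewrite (is_RInt_unique _ _ _ _ HI).
  change (K1 / beta * (g B - g A) <= K1 / beta).
  rewrite <- (Rmult_1_r (K1 / beta)) at 2.
  apply Rmult_le_compat_l; [apply Rlt_le; now apply Rdiv_lt_0_compat|].
  unfold g; pose proof (Hpos A); pose proof (Hpos B).
  assert (0 < / (1 + Rpower B beta)) by (apply Rinv_0_lt_compat; lra).
  assert (/ (1 + Rpower A beta) <= / 1) by (apply Rinv_le_contravar; lra).
  lra.
Qed.

Lemma RInt_gamma_density_monotone beta kappa A B A' B' :
  0 < A' <= A -> A <= B -> B <= B' ->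
  RInt (gamma_density beta kappa) A B <= RInt (gamma_density beta kappa) A' B'.
Proof.
intros HA HAB HB.
rewrite <- (RInt_Chasles (V := R_CompleteNormedModule) _ A' A B')
  by (apply ex_RInt_gamma_density; lra).
rewrite <- (RInt_Chasles (V := R_CompleteNormedModule) _ A B B')
  by (apply ex_RInt_gamma_density; lra).
assert (H : forall u v, 0 < u <= v -> 0 <= RInt (gamma_density beta kappa) u v).
{ intros u v Huv; apply RInt_ge_0; [easy | apply ex_RInt_gamma_density; lra|].
  intros; apply Rlt_le, gamma_density_gt0. }
pose proof (H A' A ltac:(lra)); pose proof (H B B' ltac:(lra)); unfold plus; simpl; lra.
Qed.

(** The integrals increase with the interval and are bounded, so they converge
    to their supremum, which is then the value of the improper integral. *)
Lemma Gamma_is_limit beta : 0 < beta ->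
  0 < Gamma beta /\
  forall e, 0 < e -> exists A0 B0, 0 < A0 /\ forall A B, 0 < A < A0 -> B0 < B ->
    Rabs (RInt (gamma_density beta 1) A B - Gamma beta) <= e.
Proof.
intros Hb.
destruct (RInt_gamma_density_bounded beta 1 Hb Rlt_0_1) as [K [HK HKb]].
set (I := RInt (gamma_density beta 1)) in *.
destruct (completeness (fun y => exists A B, 0 < A <= B /\ y = I A B)) as [l [Hl1 Hl2]].
{ exists K; intros y [A [B [H ->]]]; now apply HKb. }
{ exists (I 1 1), 1, 1; split; [lra | easy]. }
assert (Hlim : forall e, 0 < e -> exists A0 B0, 0 < A0 /\ forall A B, 0 < A < A0 -> B0 < B ->
    Rabs (I A B - l) < e /\ 0 < B).
{ intros e He.
  destruct (Classical_Prop.classic (exists A B, 0 < A <= B /\ l - e < I A B))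
    as [[A0 [B0 [H0 H1]]]|Hn].
  - exists A0, B0; split; [easy|]; intros A B HA HB; split; [|lra].
    assert (I A0 B0 <= I A B) by (apply RInt_gamma_density_monotone; lra).
    assert (I A B <= l) by (apply Hl1; exists A, B; split; [lra | easy]).
    apply Rabs_def1; lra.
  - exfalso; assert (l <= l - e); [|lra].
    apply Hl2; intros y [A [B [H ->]]]; apply Rnot_lt_le; intros H1; apply Hn; now exists A, B. }
assert (HG : Gamma beta = l).
{ unfold Gamma.
  refine (is_RInt_gen_unique (V := R_CompleteNormedModule) _ l _).
  intros P [d Hd].
  destruct (Hlim d (cond_pos d)) as [A0 [B0 [HA0 H]]].
  exists (fun A => 0 < A < A0) (fun B => B0 < B).
  - exists (mkposreal A0 HA0); intros A HA HA'; split; [easy|].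
    apply Rabs_def2 in HA; unfold minus, plus, opp in HA; simpl in HA; lra.
  - now exists B0.
  - intros A B HA HB; destruct (H A B HA HB) as [H1 H2]; exists (I A B); split.
    + apply (is_RInt_ext (V := R_NormedModule) (gamma_density beta 1)).
      { intros u _; unfold gamma_density; now rewrite Rmult_1_l. }
      apply (RInt_correct (V := R_CompleteNormedModule)), ex_RInt_gamma_density; lra.
    + now apply Hd. }
rewrite HG; split.
- apply Rlt_le_trans with (I 1 2).
  + apply RInt_gt_0; [lra | intros; apply gamma_density_gt0 |].
    intros u Hu; apply gamma_density_continuous; lra.
  + apply Hl1; exists 1, 2; split; [lra | easy].
- intros e He; destruct (Hlim e He) as [A0 [B0 [HA0 H]]].
  exists A0, B0; split; trivial; intros A B HA HB; apply Rlt_le; now apply H.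
Qed.

(** The factor [exp (- u)] is shared out: [exp (- theta * u)] is estimated by its
    value at [U], and the rest keeps the integral convergent. *)
Lemma upper_incomplete_gamma_bound beta theta : 0 < beta -> 0 <= theta < 1 ->
  exists K, 0 < K /\ forall U B, 0 < U <= B ->
    RInt (gamma_density beta 1) U B <= K * exp (- (theta * U)).
Proof.
intros Hb Ht.
destruct (RInt_gamma_density_bounded beta (1 - theta) Hb) as [K [HK HKb]]; [lra|].
exists K; split; trivial; intros U B HU.
apply Rle_trans with (RInt (fun u => exp (- (theta * U)) * gamma_density beta (1 - theta) u) U B).
- apply RInt_le; [easy | apply ex_RInt_gamma_density; lra | |].
  + apply ex_RInt_positive_axis; try lra; intros u Hu.
    apply continuous_Rmult; [apply continuous_const | now apply gamma_density_continuous].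
  + intros u Hu; unfold gamma_density.
    rewrite (Rmult_comm (exp _)), Rmult_assoc, <- exp_plus.
    apply Rmult_le_compat_l; [apply Rlt_le, exp_pos|]; apply exp_monotone.
    assert (theta * U <= theta * u) by (apply Rmult_le_compat_l; lra); lra.
- rewrite (RInt_scal (V := R_CompleteNormedModule) (gamma_density beta (1 - theta)))
    by (apply ex_RInt_gamma_density; lra).
  rewrite (Rmult_comm K).
  apply Rmult_le_compat_l; [apply Rlt_le, exp_pos | now apply HKb].
Qed.

Lemma lower_incomplete_gamma_bound beta A U : 0 < beta -> 0 < A <= U ->
  RInt (gamma_density beta 1) A U <= Rpower U beta / beta.
Proof.
intros Hb HAU.
assert (HI : is_RInt (fun u => beta * Rpower u (beta - 1)) A U (Rpower U beta - Rpower A beta)).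
{ apply (is_RInt_derive (V := R_CompleteNormedModule) (fun u => Rpower u beta)); intros u Hu;
    rewrite Rmin_left in Hu by easy; [apply is_derive_Rpower; lra|].
  apply continuous_Rmult; [apply continuous_const | apply continuous_Rpower; lra]. }
apply Rle_trans with (RInt (fun u => / beta * (beta * Rpower u (beta - 1))) A U).
- apply RInt_le; [easy | apply ex_RInt_gamma_density; lra | |].
  + apply (ex_RInt_scal (V := R_NormedModule)); eexists; exact HI.
  + intros u Hu; unfold gamma_density.
    replace (/ beta * (beta * Rpower u (beta - 1))) with (Rpower u (beta - 1) * 1) by (field; lra).
    apply Rmult_le_compat_l; [apply Rlt_le, exp_pos|].
    apply Rle_trans with (exp 0); [apply exp_monotone; lra | rewrite exp_0; lra].
- rewrite (RInt_scal (V := R_CompleteNormedModule) (fun u => beta * Rpower u (beta - 1)))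
    by (eexists; exact HI).
  rewrite (is_RInt_unique _ _ _ _ HI), (Rmult_comm (/ beta)).
  apply Rmult_le_compat_r; [apply Rlt_le, Rinv_0_lt_compat; lra|].
  pose proof (exp_pos (beta * ln A)); unfold Rpower at 2; lra.
Qed.

(** * The integrand on a horizontal strip *)

(** For [c = cos y], the real part of [z - exp (- z)] at [z = x + i y]. *)
Definition phase (c x : R) : R := x - c * exp (- x).

(** On the line at height [y], this is with [c = cos y] an upper bound for the
    integrand, up to a constant; with [c = kappa = 1] it is the integrand on the
    real line.  The factor [1 + c * exp (- x)] is the derivative of the phase,
    which is what makes the substitution below exact for every [c]. *)
Definition damped_integrand (beta kappa t c x : R) : R :=
  (1 + c * exp (- x)) * exp (beta * phase c x) * exp (- (kappa * (t * exp (phase c x)))).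

Definition complex_integrand (beta t : R) (z : C) : C :=
  let w := (z + - 1 * Cexp (- 1 * z))%C in
  ((1 + Cexp (- 1 * z)) * Cexp (RtoC beta * w + RtoC (- t) * Cexp w))%C.

Lemma damped_integrand_continuous beta kappa t c x :
  continuous (damped_integrand beta kappa t c) x.
Proof.
apply (ex_derive_continuous (V := R_NormedModule)).
unfold damped_integrand, phase; auto_derive; trivial.
Qed.

Lemma RInt_damped_integrand beta kappa t c a b : 0 < t ->
  Rpower t beta * RInt (damped_integrand beta kappa t c) a b =
  RInt (gamma_density beta kappa) (t * exp (phase c a)) (t * exp (phase c b)).
Proof.
intros Ht.
rewrite <- (RInt_comp (V := R_CompleteNormedModule) (gamma_density beta kappa)
  (fun x => t * exp (phase c x)) (fun x => t * ((1 + c * exp (- x)) * exp (phase c x)))).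
- rewrite <- (RInt_scal (V := R_CompleteNormedModule) (damped_integrand beta kappa t c))
    by (apply ex_RInt_cont; intros x; apply damped_integrand_continuous).
  apply RInt_ext; intros x _; unfold scal; simpl; unfold mult; simpl.
  unfold gamma_density, damped_integrand.
  assert (E : Rpower (t * exp (phase c x)) (beta - 1) * (t * exp (phase c x))
    = Rpower t beta * exp (beta * phase c x)).
  { assert (Htp : 0 < t * exp (phase c x)) by (apply Rmult_lt_0_compat; [easy | apply exp_pos]).
    rewrite <- (Rpower_1 (t * exp (phase c x))) at 2 by easy.
    rewrite <- Rpower_plus; unfold Rpower; rewrite ln_mult, ln_exp by (trivial; apply exp_pos).
    rewrite <- exp_plus; f_equal; ring. }
  set (q := exp (- (kappa * _))).
  transitivity ((1 + c * exp (- x)) * q * (Rpower t beta * exp (beta * phase c x))); [|rewrite <- E];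
    match goal with |- ?a = ?b => change (@eq R a b) end; ring.
- intros x _; apply gamma_density_continuous, Rmult_lt_0_compat; [easy | apply exp_pos].
- intros x _; split.
  + unfold phase; auto_derive; trivial; unfold Rminus; ring.
  + apply (ex_derive_continuous (V := R_NormedModule)
      (fun x => t * ((1 + c * exp (- x)) * exp (phase c x)))).
    unfold phase; auto_derive; trivial.
Qed.

Lemma complex_integrand_holo beta t :
  exists F', forall z, holo_at (complex_integrand beta t) F' z.
Proof.
assert (HE : exists E', forall z, holo_at (fun z => Cexp (- 1 * z)%C) E' z).
{ eexists; intros z; apply holo_exp, holo_mult; [apply holo_const | apply holo_id]. }
destruct HE as [E' HE].
assert (HW : exists W', forall z, holo_at (fun z => z + - 1 * Cexp (- 1 * z))%C W' z).
{ eexists; intros z; apply holo_plus; [apply holo_id|].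
  apply holo_mult; [apply holo_const | apply HE]. }
destruct HW as [W' HW].
eexists; intros z; unfold complex_integrand; apply holo_mult.
- apply holo_plus; [apply holo_const | apply HE].
- apply holo_exp, holo_plus; (apply holo_mult; [apply holo_const|]); [apply HW|].
  apply holo_exp, HW.
Qed.

Lemma complex_integrand_real beta t x :
  complex_integrand beta t (x, 0) = RtoC (damped_integrand beta 1 t 1 x).
Proof.
unfold complex_integrand, damped_integrand, phase.
assert (E : Cexp (- 1 * (x, 0))%C = RtoC (exp (- x))).
{ apply injective_projections; simpl.
  - replace (-1 * x - 0 * 0) with (- x) by ring.
    replace (-1 * 0 + 0 * x) with 0 by ring. rewrite cos_0; ring.
  - replace (-1 * 0 + 0 * x) with 0 by ring. rewrite sin_0; ring. }
assert (ER : forall u : R, Cexp (RtoC u) = RtoC (exp u)).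
{ intros u; apply injective_projections; simpl; rewrite ?cos_0, ?sin_0; ring. }
rewrite E.
replace ((x, 0) + - 1 * RtoC (exp (- x)))%C with (RtoC (x - 1 * exp (- x)))
  by (apply injective_projections; simpl; ring).
rewrite ER, <- !RtoC_mult, <- !RtoC_plus, ER, <- RtoC_mult.
f_equal; rewrite exp_plus, Rmult_assoc, (Rmult_1_l (exp (- x))), !Rmult_1_l.
do 2 f_equal; f_equal; ring.
Qed.

Lemma Cmod_complex_integrand beta t x y :
  Cmod (complex_integrand beta t (x, y)) <=
  (1 + exp (- x)) * exp (beta * phase (cos y) x)
    * exp (- (t * (exp (phase (cos y) x) * cos (y + exp (- x) * sin y)))).
Proof.
unfold complex_integrand.
set (w := ((x, y) + - 1 * Cexp (- 1 * (x, y)))%C).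
assert (EE : Cexp (- 1 * (x, y))%C = (exp (- x) * cos y, - (exp (- x) * sin y))).
{ unfold Cexp; apply injective_projections; simpl.
  - replace (-1 * x - 0 * y) with (- x) by ring.
    replace (-1 * y + 0 * x) with (- y) by ring. now rewrite cos_neg.
  - replace (-1 * x - 0 * y) with (- x) by ring.
    replace (-1 * y + 0 * x) with (- y) by ring. rewrite sin_neg; ring. }
assert (Ew : w = (phase (cos y) x, y + exp (- x) * sin y)).
{ unfold w, phase; rewrite EE; apply injective_projections; simpl; ring. }
rewrite Cmod_mult, Cmod_Cexp, Rmult_assoc, <- exp_plus, Ew.
apply Rmult_le_compat.
- apply Cmod_ge_0.
- apply Rlt_le, exp_pos.
- eapply Rle_trans; [apply Cmod_triangle|].
  rewrite Cmod_1, Cmod_Cexp; simpl.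
  right; do 2 f_equal; ring.
- right; f_equal; simpl; ring.
Qed.

(** The last factor of the integrand has modulus
    [exp (- t * p * cos (y + exp (- x) * sin y))], where [p = exp (phase (cos y) x)].
    If [exp (- x) <= m], half the gap between [r] and [PI / 2], the angle is at
    most [r + m < PI / 2] and its cosine at least [kappa = cos (r + m)].
    Otherwise the cosine may be negative, but then [t * p <= exp x < 1 / m], as
    [t <= 1], and the loss is a constant factor. *)
Lemma complex_integrand_strip_bound r : 0 < r < PI / 2 ->
  exists A kappa, 0 < A /\ 0 < kappa /\
  forall beta t x y, 0 < t <= 1 -> 0 <= y <= r ->
    Cmod (complex_integrand beta t (x, y)) <= A * damped_integrand beta kappa t (cos y) x.
Proof.
intros Hr.
(* The angle may exceed [r] by at most [m], half of the room left below [PI / 2]. *)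
set (m := (PI / 2 - r) / 2).
assert (Hm : 0 < m) by (unfold m; lra).
assert (Hk : 0 < cos (r + m)) by (apply cos_gt_0; unfold m; lra).
assert (Hc : 0 < cos r) by (apply cos_gt_0; lra).
exists (exp (2 / m) / cos r), (cos (r + m)); split; [|split; trivial].
{ apply Rdiv_lt_0_compat; [apply exp_pos | easy]. }
intros beta t x y Ht Hy.
eapply Rle_trans; [apply Cmod_complex_integrand|].
assert (Hcy : cos r <= cos y) by (apply cos_decr_1; lra).
pose proof (COS_bound r); pose proof (COS_bound y).
pose proof (exp_pos (- x)) as Hx.
set (p := exp (phase (cos y) x)).
assert (Hp : 0 < p) by apply exp_pos.
unfold damped_integrand; fold p.
assert (H1 : 1 + exp (- x) <= / cos r * (1 + cos y * exp (- x))).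
{ rewrite Rmult_comm; apply Rle_div_r; [easy|]. nra. }
assert (H2 : cos (r + m) * (t * p) - 2 / m <= t * (p * cos (y + exp (- x) * sin y))).
{ assert (H2m : 0 < 2 / m) by (apply Rdiv_lt_0_compat; lra).
  assert (Htp : 0 < t * p) by (apply Rmult_lt_0_compat; lra).
  destruct (Rle_or_lt (exp (- x)) m) as [Hxm|Hxm].
  - pose proof (SIN_bound y) as Hs.
    assert (0 <= sin y) by (apply sin_ge_0; lra).
    assert (0 <= exp (- x) * sin y <= m).
    { split; [apply Rmult_le_pos; lra|].
      rewrite <- (Rmult_1_r m); apply Rmult_le_compat; lra. }
    assert (cos (r + m) <= cos (y + exp (- x) * sin y)) by (apply cos_decr_1; unfold m in *; lra).
    assert (t * p * cos (r + m) <= t * p * cos (y + exp (- x) * sin y))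
      by (apply Rmult_le_compat_l; lra).
    lra.
  - pose proof (COS_bound (r + m)); pose proof (COS_bound (y + exp (- x) * sin y)).
    assert (Hpx : t * p <= / m).
    { apply Rle_trans with p; [nra|].
      apply Rle_trans with (exp x).
      - apply exp_monotone; unfold phase.
        assert (0 <= cos y * exp (- x)) by (apply Rmult_le_pos; lra); lra.
      - rewrite <- (Ropp_involutive x), exp_Ropp; apply Rinv_le_contravar; lra. }
    assert (t * p * (cos (r + m) - cos (y + exp (- x) * sin y)) <= / m * 2)
      by (apply Rle_trans with (t * p * 2); [apply Rmult_le_compat_l | apply Rmult_le_compat_r]; lra).
    unfold Rdiv; lra. }
apply Rle_trans with ((/ cos r * (1 + cos y * exp (- x))) * exp (beta * phase (cos y) x)
  * (exp (2 / m) * exp (- (cos (r + m) * (t * p))))).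
- apply Rmult_le_compat.
  + apply Rmult_le_pos; [lra | apply Rlt_le, exp_pos].
  + apply Rlt_le, exp_pos.
  + apply Rmult_le_compat_r; [apply Rlt_le, exp_pos | easy].
  + rewrite <- exp_plus; apply exp_monotone; lra.
- right; unfold Rdiv; ring.
Qed.

(** The decay at both ends is much faster, but a rate uniform in [c] suffices for
    the vertical edges: to the left it comes from [exp (- beta * c * exp (- x))],
    to the right from the last factor. *)
Lemma damped_integrand_vanishes beta kappa t c0 : 0 < beta -> 0 < kappa -> 0 < t -> 0 < c0 ->
  exists K, 0 < K /\ forall c x, c0 <= c <= 1 -> x <> 0 ->
    damped_integrand beta kappa t c x <= K / Rabs x.
Proof.
intros Hb Hk Ht Hc0.
assert (Hkt : 0 < kappa * t) by now apply Rmult_lt_0_compat.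
assert (Hbc : 0 < beta * c0) by now apply Rmult_lt_0_compat.
set (K1 := Rpower ((beta + 1) / (kappa * t)) (beta + 1)).
set (K2 := Rpower (2 / (beta * c0)) 2).
assert (HK1 : 0 < K1) by apply exp_pos.
assert (HK2 : 0 < K2) by apply exp_pos.
exists (2 * (K1 + K2)); split; [lra|].
intros c x Hc Hx; unfold damped_integrand.
pose proof (exp_pos (- x)) as Hex.
destruct (Rle_or_lt x 0) as [Hx0|Hx0].
- rewrite Rabs_left by lra.
  set (s := exp (- x)) in *.
  assert (Hs : - x <= s) by (pose proof (exp_ineq1_le (- x)); unfold s; lra).
  assert (Hs1 : 1 <= s) by (unfold s; rewrite <- exp_0; apply exp_monotone; lra).
  assert (Hq : exp (beta * phase c x) <= exp (- (beta * c0 * s))).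
  { apply exp_monotone; unfold phase; fold s.
    assert (c0 * s <= c * s) by (apply Rmult_le_compat_r; lra).
    rewrite Rmult_assoc, Ropp_mult_distr_r; apply Rmult_le_compat_l; lra. }
  assert (H3 : exp (- (kappa * (t * exp (phase c x)))) <= 1).
  { rewrite <- exp_0; apply exp_monotone; rewrite <- Rmult_assoc.
    pose proof (Rmult_lt_0_compat _ _ Hkt (exp_pos (phase c x))); lra. }
  pose proof (Rpower_exp_bound 2 (beta * c0) s ltac:(lra) Hbc ltac:(lra)) as HR.
  fold K2 in HR.
  assert (E2 : Rpower s 2 = s ^ 2) by (rewrite <- Rpower_pow by lra; f_equal; simpl; ring).
  rewrite E2 in HR.
  apply Rle_trans with (2 * s * exp (- (beta * c0 * s)) * 1).
  + apply Rmult_le_compat; trivial.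
    * apply Rmult_le_pos; [nra | apply Rlt_le, exp_pos].
    * apply Rlt_le, exp_pos.
    * apply Rmult_le_compat; trivial; [nra | apply Rlt_le, exp_pos | nra].
  + apply Rle_trans with (2 * K2 / s).
    * rewrite Rmult_1_r; apply (Rle_div_r _ _ s); [lra|].
      replace (2 * s * exp (- (beta * c0 * s)) * s)
        with (2 * (s ^ 2 * exp (- (beta * c0 * s)))) by ring; lra.
    * apply Rmult_le_compat; try lra.
      -- apply Rlt_le, Rinv_0_lt_compat; lra.
      -- apply Rinv_le_contravar; lra.
- rewrite Rabs_pos_eq by lra.
  set (u := exp (phase c x)).
  assert (Hu : 0 < u) by apply exp_pos.
  assert (He1 : exp (- x) <= 1) by (rewrite <- exp_0; apply exp_monotone; lra).
  assert (Hux : x <= u).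
  { pose proof (exp_ineq1_le (phase c x)) as H; fold u in H; unfold phase in H; nra. }
  pose proof (Rpower_exp_bound (beta + 1) (kappa * t) u ltac:(lra) Hkt Hu) as HR.
  fold K1 in HR; rewrite Rpower_plus, Rpower_1 in HR by easy.
  assert (Eu : exp (beta * phase c x) = Rpower u beta).
  { unfold Rpower, u; now rewrite ln_exp. }
  rewrite Eu.
  pose proof (exp_pos (beta * ln u)) as HP; fold (Rpower u beta) in HP.
  pose proof (exp_pos (- (kappa * t * u))) as HQ.
  rewrite <- Rmult_assoc with (r1 := kappa).
  apply Rle_trans with (2 * (Rpower u beta * exp (- (kappa * t * u)))).
  + rewrite Rmult_assoc; apply Rmult_le_compat_r; [nra | nra].
  + apply Rle_trans with (2 * K1 / u).
    * apply (Rle_div_r _ _ u); [lra|]; lra.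
    * apply Rmult_le_compat; try lra.
      -- apply Rlt_le, Rinv_0_lt_compat; lra.
      -- apply Rinv_le_contravar; lra.
Qed.

(** * Sums over windows of nodes *)

Definition window_sum (phi : Z -> R) (M N : nat) : R :=
  sum_n (fun k => phi (Z.of_nat k - Z.of_nat M)%Z) (M + N).

Lemma window_sum_right phi M N :
  window_sum phi M (S N) = window_sum phi M N + phi (Z.of_nat (S N)).
Proof.
unfold window_sum; rewrite Nat.add_succ_r, sum_Sn.
change (@eq R (sum_n (fun k => phi (Z.of_nat k - Z.of_nat M)%Z) (M + N)
   + phi (Z.of_nat (S (M + N)) - Z.of_nat M)%Z)
   (sum_n (fun k => phi (Z.of_nat k - Z.of_nat M)%Z) (M + N) + phi (Z.of_nat (S N)))).
do 2 f_equal; lia.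
Qed.

Lemma window_sum_left phi M N :
  window_sum phi (S M) N = phi (- Z.of_nat (S M))%Z + window_sum phi M N.
Proof.
unfold window_sum, sum_n; rewrite Nat.add_succ_l, sum_Sn_m by lia.
rewrite <- sum_n_m_S.
rewrite (sum_n_m_ext (fun k => phi (Z.of_nat (S k) - Z.of_nat (S M))%Z)
   (fun k => phi (Z.of_nat k - Z.of_nat M)%Z)) by (intros k; f_equal; lia).
reflexivity.
Qed.

(** Each added term is compared with the integral of [f] over the step between
    its node and the neighbouring node closer to the origin. *)
Lemma window_sum_extension (f : R -> R) h M N j : 0 < h ->
  (forall x, continuous f x) -> (forall x, 0 <= f x) ->
  (forall x y, x <= y <= - (INR M * h) -> f x <= f y) ->
  (forall x y, INR N * h <= x <= y -> f y <= f x) ->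
  let phi := fun n => h * f (IZR n * h) in
  0 <= window_sum phi (M + j) (N + j) - window_sum phi M N
  <= RInt f (- (INR (M + j) * h)) (- (INR M * h)) + RInt f (INR N * h) (INR (N + j) * h).
Proof.
intros Hh Hc Hf Hincr Hdecr phi.
induction j as [|j IH].
- rewrite !Nat.add_0_r, !RInt_point; unfold zero; simpl; lra.
- rewrite !Nat.add_succ_r, window_sum_left, window_sum_right.
  rewrite <- (RInt_Chasles (V := R_CompleteNormedModule) f _ (- (INR (M + j) * h)))
    by now apply ex_RInt_cont.
  rewrite <- (RInt_Chasles (V := R_CompleteNormedModule) f (INR N * h) (INR (N + j) * h))
    by now apply ex_RInt_cont.
  set (uM := INR (M + j) * h) in *; set (uN := INR (N + j) * h) in *.
  assert (EM : INR (S (M + j)) * h = uM + h) by (rewrite S_INR; unfold uM; ring).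
  assert (EN : INR (S (N + j)) * h = uN + h) by (rewrite S_INR; unfold uN; ring).
  assert (HuM : INR M * h <= uM).
  { apply Rmult_le_compat_r; [lra|]; apply le_INR; lia. }
  assert (HuN : INR N * h <= uN).
  { apply Rmult_le_compat_r; [lra|]; apply le_INR; lia. }
  rewrite EM, EN.
  assert (E1 : phi (- Z.of_nat (S (M + j)))%Z = h * f (- (uM + h))).
  { unfold phi; rewrite opp_IZR, <- INR_IZR_INZ, <- EM; do 2 f_equal; ring. }
  assert (E2 : phi (Z.of_nat (S (N + j))) = h * f (uN + h)).
  { unfold phi; now rewrite <- INR_IZR_INZ, <- EN. }
  rewrite E1, E2.
  assert (H1 : h * f (- (uM + h)) <= RInt f (- (uM + h)) (- uM)).
  { replace (h * f (- (uM + h))) with (RInt (fun _ => f (- (uM + h))) (- (uM + h)) (- uM))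
      by (rewrite RInt_const; unfold scal; simpl; unfold mult; simpl; ring).
    apply RInt_le; [lra | apply ex_RInt_const | now apply ex_RInt_cont |].
    intros x Hx; apply Hincr; lra. }
  assert (H2 : h * f (uN + h) <= RInt f uN (uN + h)).
  { replace (h * f (uN + h)) with (RInt (fun _ => f (uN + h)) uN (uN + h))
      by (rewrite RInt_const; unfold scal; simpl; unfold mult; simpl; ring).
    apply RInt_le; [lra | apply ex_RInt_const | now apply ex_RInt_cont |].
    intros x Hx; apply Hdecr; lra. }
  assert (0 <= h * f (- (uM + h))) by (apply Rmult_le_pos; [lra | apply Hf]).
  assert (0 <= h * f (uN + h)) by (apply Rmult_le_pos; [lra | apply Hf]).
  unfold plus in *; simpl in *; lra.
Qed.

(** * The integrand on the real line *)

Local Notation integrand beta t := (damped_integrand beta 1 t 1).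

Lemma exp_sum_window_sum beta h M N t :
  exp_sum beta h M N t = window_sum (fun n => h * integrand beta t (IZR n * h)) M N.
Proof.
apply sum_n_ext; intros k; cbv zeta.
unfold w_coef, a_coef, damped_integrand, phase.
set (x := IZR _ * h); rewrite !Rmult_1_l, !Rmult_assoc, (Rmult_comm (exp _) t); reflexivity.
Qed.

Lemma integrand_ge0 beta t x : 0 <= integrand beta t x.
Proof.
unfold damped_integrand; pose proof (exp_pos (- x)).
repeat apply Rmult_le_pos; try (apply Rlt_le, exp_pos); lra.
Qed.

Lemma phase_monotone c x y : 0 <= c -> x <= y -> phase c x <= phase c y.
Proof.
intros Hc Hxy; unfold phase.
assert (c * exp (- y) <= c * exp (- x)) by (apply Rmult_le_compat_l; [easy | apply exp_monotone; lra]).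
lra.
Qed.

Lemma is_derive_integrand beta t x :
  is_derive (integrand beta t) x
    (integrand beta t x *
       ((beta - t * exp (phase 1 x)) * (1 + exp (- x)) - exp (- x) / (1 + exp (- x)))).
Proof.
pose proof (exp_pos (- x)).
unfold damped_integrand, phase; auto_derive; trivial.
unfold Rminus; field; lra.
Qed.

Lemma monotone_of_derivative_ge0 (f df : R -> R) x y : x <= y ->
  (forall z, is_derive f z (df z)) -> (forall z, x <= z <= y -> 0 <= df z) -> f x <= f y.
Proof.
intros Hxy Hd Hp.
destruct (MVT_gen f x y df) as [z [Hz E]].
- intros z _; apply Hd.
- intros z _; apply continuity_pt_filterlim, (ex_derive_continuous (V := R_NormedModule) f).
  eexists; apply Hd.
- rewrite Rmin_left, Rmax_right in Hz by easy.
  assert (0 <= df z * (y - x)) by (apply Rmult_le_pos; [now apply Hp | lra]); lra.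
Qed.

(** Since [t * exp (phase 1 z) <= exp z <= beta / 2], the logarithmic derivative
    is at least [exp z * (1 + exp (- z)) - 1 >= 0]. *)
Lemma integrand_increasing beta t x y : 0 < t <= 1 -> x <= y -> exp y <= beta / 2 ->
  integrand beta t x <= integrand beta t y.
Proof.
intros Ht Hxy Hy.
apply (monotone_of_derivative_ge0 _ _ x y Hxy (is_derive_integrand beta t)).
intros z Hz; apply Rmult_le_pos; [apply integrand_ge0|].
assert (Hez : exp z <= beta / 2) by (eapply Rle_trans; [apply exp_monotone, Hz | easy]).
pose proof (exp_pos (- z)) as He; pose proof (exp_pos z) as He'; pose proof (exp_pos (phase 1 z)).
assert (Hinv : exp z * exp (- z) = 1) by (rewrite exp_Ropp; field; lra).
assert (Hp : exp (phase 1 z) <= exp z) by (apply exp_monotone; unfold phase; lra).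
assert (exp (- z) / (1 + exp (- z)) <= 1) by (apply Rle_div_l; lra).
assert (Htp : t * exp (phase 1 z) <= exp z) by nra.
assert (exp z * (1 + exp (- z)) <= (beta - t * exp (phase 1 z)) * (1 + exp (- z)))
  by (apply Rmult_le_compat_r; lra).
lra.
Qed.

Lemma integrand_decreasing beta t x y : 0 < t -> x <= y -> beta <= t * exp (phase 1 x) ->
  integrand beta t y <= integrand beta t x.
Proof.
intros Ht Hxy Hx.
apply Ropp_le_cancel.
apply (monotone_of_derivative_ge0 (fun z => - integrand beta t z)
  (fun z => - (integrand beta t z *
       ((beta - t * exp (phase 1 z)) * (1 + exp (- z)) - exp (- z) / (1 + exp (- z))))) x y Hxy).
- intros z; apply (is_derive_opp (V := R_NormedModule)), is_derive_integrand.
- intros z Hz.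
  rewrite Ropp_mult_distr_r; apply Rmult_le_pos; [apply integrand_ge0|].
  assert (t * exp (phase 1 x) <= t * exp (phase 1 z)).
  { apply Rmult_le_compat_l; [lra|]; apply exp_monotone, phase_monotone; lra. }
  pose proof (exp_pos (- z)).
  assert (0 <= exp (- z) / (1 + exp (- z))) by (apply Rdiv_le_0_compat; lra).
  assert (0 <= (t * exp (phase 1 z) - beta) * (1 + exp (- z))) by (apply Rmult_le_pos; lra).
  lra.
Qed.

(** * Passing to the Gamma function *)

Lemma Gamma_by_substitution beta t e : 0 < beta -> 0 < t <= 1 -> 0 < e ->
  exists X, forall a b, a < - X -> X < b ->
    Rabs (Rpower t beta * RInt (integrand beta t) a b - Gamma beta) <= e.
Proof.
intros Hb Ht He.
destruct (Gamma_is_limit beta Hb) as [_ HG].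
destruct (HG e He) as [A0 [B0 [HA0 H]]].
assert (HA1 : 0 < / A0) by now apply Rinv_0_lt_compat.
pose proof (Rabs_pos (B0 / t)) as HB1; pose proof (Rle_abs (B0 / t)) as HB2.
exists (/ A0 + Rabs (B0 / t)); intros a b Ha Hbb.
rewrite RInt_damped_integrand by easy; apply H.
- pose proof (exp_pos (phase 1 a)) as Hp.
  assert (exp (phase 1 a) < A0); [|nra].
  apply Rle_lt_trans with (exp a).
  + apply exp_monotone; unfold phase; pose proof (exp_pos (- a)); lra.
  + rewrite <- (Ropp_involutive a), exp_Ropp, <- (Rinv_inv A0).
    apply Rinv_lt_contravar.
    * apply Rmult_lt_0_compat; [easy | apply exp_pos].
    * pose proof (exp_ineq1_le (- a)); lra.
- assert (Hbp : b <= exp (phase 1 b)).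
  { pose proof (exp_ineq1_le (phase 1 b)) as H1; unfold phase in H1 at 1.
    assert (exp (- b) <= exp 0) by (apply exp_monotone; lra); rewrite exp_0 in *; lra. }
  apply Rle_lt_trans with (t * (B0 / t)); [right; field; lra|].
  apply Rmult_lt_compat_l; lra.
Qed.

(** A predicate on [C], so that a constant with this property can be selected as
    a function of [beta] and [r]. *)
Definition discretization_constant_spec (beta r C : R) : Prop :=
  0 < C /\ forall t h M N e, 0 < t <= 1 -> 0 < h -> 0 < e ->
    exp (- (2 * PI * r / h)) <= / 2 ->
    exists j, Rabs (Rpower t beta * exp_sum beta h (M + j) (N + j) t - Gamma beta)
              <= Gamma beta * C * exp (- (2 * PI * r / h)) + e.

(** The window is enlarged by [j] on both sides until the vertical edges and the
    distance to [Gamma beta] together contribute at most [e]; the constant does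
    not depend on the window.  The condition on [h] bounds [s / (1 - s)] by
    [2 * s]. *)
Lemma discretization_constant_exists beta r : 0 < beta -> 0 < r < PI / 2 ->
  exists C, discretization_constant_spec beta r C.
Proof.
intros Hb Hr.
destruct (complex_integrand_strip_bound r Hr) as [A [kappa [HA [Hk HAk]]]].
destruct (RInt_gamma_density_bounded beta kappa Hb Hk) as [K [HK HKb]].
destruct (Gamma_is_limit beta Hb) as [HG _].
exists (4 * A * K / Gamma beta); split.
{ apply Rdiv_lt_0_compat; [|easy]; repeat apply Rmult_lt_0_compat; lra. }
intros t h M N e Ht Hh He Hs.
assert (Hc0 : 0 < cos r) by (apply cos_gt_0; lra).
destruct (damped_integrand_vanishes beta kappa t (cos r)) as [V [HV HVb]]; trivial; [lra|].
destruct (Gamma_by_substitution beta t (e / 2)) as [X HX]; trivial; [lra|].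
(* Far enough out, the edge term [2 * B * r], with [B = 2 * A * (V / Y)], is [e / 2]. *)
set (Y := 8 * A * V * r / e).
assert (HY : 0 < Y) by (apply Rdiv_lt_0_compat; [repeat apply Rmult_lt_0_compat|]; lra).
destruct (INR_unbounded ((Rabs X + Y) / h)) as [j Hj].
exists j.
pose proof (Rabs_pos X) as HX0; pose proof (Rle_abs X) as HX1.
assert (Hjh : Rabs X + Y < INR j * h).
{ apply Rgt_lt, (Rmult_lt_compat_r h) in Hj; [|easy].
  replace ((Rabs X + Y) / h * h) with (Rabs X + Y) in Hj by (field; lra); easy. }
set (a := - ((INR (M + j) + / 2) * h)).
set (b := (INR (N + j) + / 2) * h).
assert (Ha : a < - (Rabs X + Y)).
{ unfold a; rewrite plus_INR; pose proof (Rmult_le_pos _ h (pos_INR M)); lra. }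
assert (Hbb : Rabs X + Y < b).
{ unfold b; rewrite plus_INR; pose proof (Rmult_le_pos _ h (pos_INR N)); lra. }
specialize (HX a b ltac:(lra) ltac:(lra)).
destruct (complex_integrand_holo beta t) as [F' HF].
pose proof (trapezoidal_rule_error (complex_integrand beta t) F' (integrand beta t)
  (fun x => A * damped_integrand beta kappa t (cos r) x) h r (2 * A * (V / Y)) (M + j) (N + j)
  Hh ltac:(lra) HF (complex_integrand_real beta t)) as Htrap.
cbv zeta in Htrap; fold a b in Htrap.
set (s := exp (- (2 * PI * r / h))) in *.
assert (Hs0 : 0 < s) by apply exp_pos.
assert (HT0 : 0 < Rpower t beta) by apply exp_pos.
assert (HT1 : Rpower t beta <= 1).
{ unfold Rpower; apply Rle_trans with (exp 0); [apply exp_monotone | rewrite exp_0; lra].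
  assert (ln t <= 0) by (rewrite <- ln_1; apply ln_le; lra).
  nra. }
assert (Hedge : forall y u, 0 <= y <= r -> u <> 0 -> Y <= Rabs u ->
  Cmod (complex_integrand beta t (u, y)) <= A * (V / Y)).
{ intros y u Hy Hu HuY; eapply Rle_trans; [now apply HAk|].
  apply Rmult_le_compat_l; [lra|].
  pose proof (COS_bound y).
  eapply Rle_trans; [apply HVb; trivial; split; [apply cos_decr_1|]; lra|].
  apply Rmult_le_compat_l; [lra|]; apply Rinv_le_contravar; lra. }
assert (Hk' : ex_RInt (damped_integrand beta kappa t (cos r)) a b).
{ apply ex_RInt_cont; intros x; apply damped_integrand_continuous. }
assert (Htop : Rpower t beta * RInt (fun x => A * damped_integrand beta kappa t (cos r) x) a b <= A * K).
{ rewrite (RInt_scal (V := R_CompleteNormedModule) (damped_integrand beta kappa t (cos r))) by easy.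
  change (Rpower t beta * (A * RInt (damped_integrand beta kappa t (cos r)) a b) <= A * K).
  replace (Rpower t beta * (A * RInt (damped_integrand beta kappa t (cos r)) a b))
   with (A * (Rpower t beta * RInt (damped_integrand beta kappa t (cos r)) a b)) by ring.
  rewrite RInt_damped_integrand by easy.
  apply Rmult_le_compat_l; [lra|]; apply HKb; split.
  - apply Rmult_lt_0_compat; [easy | apply exp_pos].
  - apply Rmult_le_compat_l; [lra|]; apply exp_monotone, phase_monotone; lra. }
specialize (Htrap ltac:(intros x; apply (continuous_Rmult (fun _ => A));
  [apply continuous_const | apply damped_integrand_continuous])
  ltac:(intros x; apply HAk; lra)).
assert (Htrap' := Htrap ltac:(intros y Hy;
  pose proof (Hedge y a Hy ltac:(lra) ltac:(rewrite Rabs_left; lra));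
  pose proof (Hedge y b Hy ltac:(lra) ltac:(rewrite Rabs_pos_eq; lra)); lra)).
clear Htrap.
rewrite exp_sum_window_sum; unfold window_sum; cbv beta in *.
set (S := sum_n _ _) in *.
set (I := RInt (integrand beta t) a b) in *.
set (J := RInt (fun x => A * _) a b) in *.
assert (Hs1 : s / (1 - s) <= 2 * s).
{ apply (Rle_div_l _ _ (1 - s)); nra. }
assert (Hs2 : 0 <= s / (1 - s)) by (apply Rdiv_le_0_compat; lra).
assert (HTS : Rabs (Rpower t beta * S - Rpower t beta * I) <= 4 * A * K * s + e / 2).
{ rewrite <- Rmult_minus_distr_l, Rabs_mult, (Rabs_pos_eq (Rpower t beta)) by lra.
  eapply Rle_trans; [apply Rmult_le_compat_l; [lra | exact Htrap']|].
  replace (2 * (2 * A * (V / Y)) * r) with (e / 2) by (unfold Y; field; lra).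
  rewrite Rmult_plus_distr_l; apply Rplus_le_compat.
  - replace (Rpower t beta * (2 * (s / (1 - s)) * J)) with (2 * (s / (1 - s)) * (Rpower t beta * J)) by ring.
    apply Rle_trans with (2 * (s / (1 - s)) * (A * K)); [apply Rmult_le_compat_l; lra|].
    assert (0 < A * K) by (apply Rmult_lt_0_compat; lra).
    nra.
  - rewrite <- (Rmult_1_l (e / 2)) at 2; apply Rmult_le_compat_r; lra. }
replace (Gamma beta * (4 * A * K / Gamma beta) * s) with (4 * A * K * s) by (field; lra).
apply Rabs_le_between in HTS; apply Rabs_le_between in HX; apply Rabs_le; lra.
Qed.

(** * The three error contributions *)

Lemma le_ln_ratio x C eps : 0 < C -> 0 < eps <= C * exp (- x) -> x <= ln (C / eps).
Proof.
intros HC [He H].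
rewrite <- (ln_exp x); apply ln_le; [apply exp_pos|].
apply (Rle_div_r _ _ eps); [easy|].
apply Rle_trans with (exp x * (C * exp (- x))); [apply Rmult_le_compat_l; [apply Rlt_le, exp_pos | easy]|].
rewrite exp_Ropp; right; field; apply Rgt_not_eq, exp_pos.
Qed.

Lemma exp_neg_ln_ratio C eps : 0 < C -> 0 < eps -> exp (- ln (C / eps)) = eps / C.
Proof.
intros HC He; rewrite exp_Ropp, exp_ln by now apply Rdiv_lt_0_compat.
field; lra.
Qed.

(** The substituted endpoint is [t * exp (- X - exp X)], at most
    [exp (- exp X)]. *)
Lemma left_tail_bound beta t X x L : 0 < beta -> 0 < t <= 1 -> 0 <= X -> x <= - X ->
  L <= beta * exp X ->
  Rpower t beta * RInt (integrand beta t) x (- X) <= exp (- L) / beta.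
Proof.
intros Hb Ht HX Hx HL.
rewrite RInt_damped_integrand by easy.
eapply Rle_trans; [apply lower_incomplete_gamma_bound; [easy|]; split|].
- apply Rmult_lt_0_compat; [easy | apply exp_pos].
- apply Rmult_le_compat_l; [lra|]; apply exp_monotone, phase_monotone; lra.
- apply Rmult_le_compat_r; [apply Rlt_le, Rinv_0_lt_compat; lra|].
  unfold Rpower; apply exp_monotone.
  rewrite ln_mult, ln_exp by (apply exp_pos || lra).
  assert (Hln : ln t <= 0) by (rewrite <- ln_1; apply ln_le; lra).
  unfold phase; rewrite Ropp_involutive.
  assert (beta * (ln t + (- X - 1 * exp X)) <= beta * (- exp X)) by (apply Rmult_le_compat_l; lra).
  lra.
Qed.

(** Replacing [exp (phase 1 X)] by [exp X] costs at most [1], since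
    [exp (X - exp (- X)) >= exp X * (1 - exp (- X))]. *)
Lemma right_tail_exponent theta delta t X L : 0 < theta < 1 -> 0 < delta <= t -> t <= 1 ->
  0 < L -> L / (theta * delta) <= exp X -> L - 1 <= theta * (t * exp (phase 1 X)).
Proof.
intros Hth Hd Ht HL HX.
assert (Htd : 0 < theta * delta) by (apply Rmult_lt_0_compat; lra).
assert (HLX : L <= theta * delta * exp X).
{ apply (Rmult_le_compat_l (theta * delta)) in HX; [|lra].
  replace (theta * delta * (L / (theta * delta))) with L in HX by (field; lra); lra. }
pose proof (exp_pos X) as HeX; pose proof (exp_pos (- X)) as HeX'.
assert (Hinv : exp X * exp (- X) = 1) by (rewrite exp_Ropp; field; lra).
assert (Hp : exp X - 1 <= exp (phase 1 X)).
{ unfold phase, Rminus at 2; rewrite exp_plus.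
  pose proof (exp_ineq1_le (- (1 * exp (- X)))).
  apply Rle_trans with (exp X * (1 + - (1 * exp (- X)))); [lra|].
  apply Rmult_le_compat_l; lra. }
assert (Htt : 0 < theta * t) by (apply Rmult_lt_0_compat; lra).
assert (theta * t * (exp X - 1) <= theta * t * exp (phase 1 X)) by (apply Rmult_le_compat_l; lra).
assert (theta * delta * exp X <= theta * t * exp X).
{ apply Rmult_le_compat_r; [lra|]; apply Rmult_le_compat_l; lra. }
assert (theta * t <= 1 * 1) by (apply Rmult_le_compat; lra).
lra.
Qed.

(** The [1] added in the exponent compensates the [1] lost in
    [right_tail_exponent]. *)
Definition right_tail_constant_spec (beta theta C : R) : Prop :=
  0 < C /\ forall U B, 0 < U <= B ->
    RInt (gamma_density beta 1) U B <= Gamma beta * C * exp (- (theta * U + 1)).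

Lemma right_tail_constant_exists beta theta : 0 < beta -> 0 < theta < 1 ->
  exists C, right_tail_constant_spec beta theta C.
Proof.
intros Hb Hth.
destruct (Gamma_is_limit beta Hb) as [HG _].
destruct (upper_incomplete_gamma_bound beta theta Hb ltac:(lra)) as [K [HK HKb]].
pose proof (exp_pos 1).
exists (exp 1 * K / Gamma beta); split.
{ apply Rdiv_lt_0_compat; [now apply Rmult_lt_0_compat | easy]. }
intros U B HU; eapply Rle_trans; [apply HKb; lra|].
rewrite Ropp_plus_distr, exp_plus, (exp_Ropp 1); right; field; lra.
Qed.

(** [2 <= L2] and [beta + 1 <= L3] bring the two tails into the ranges where the
    integrand is monotone. *)
Lemma truncation_error beta theta C3 delta t h M N L2 L3 j :
  0 < beta -> 0 < theta < 1 -> right_tail_constant_spec beta theta C3 ->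
  0 < delta <= t -> t <= 1 -> 0 < h -> 2 <= L2 -> beta + 1 <= L3 ->
  INR M >= 1 / h * ln (1 / beta * L2) ->
  INR N >= 1 + 1 / h * ln (1 / (theta * delta) * L3) ->
  0 <= Rpower t beta * (exp_sum beta h (M + j) (N + j) t - exp_sum beta h M N t)
    <= exp (- L2) / beta + Gamma beta * C3 * exp (- L3).
Proof.
intros Hb Hth [HC3 HC3b] Hd Ht Hh HL2 HL3 HM HN.
destruct (Gamma_is_limit beta Hb) as [HG _].
assert (HT0 : 0 < Rpower t beta) by apply exp_pos.
assert (Hscale : forall u v, u >= 1 / h * v -> v <= u * h).
{ intros u v Huv; apply Rge_le, (Rmult_le_compat_r h) in Huv; [|lra].
  replace (1 / h * v * h) with v in Huv by (field; lra); easy. }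
assert (HeM : L2 / beta <= exp (INR M * h)).
{ apply Hscale in HM.
  rewrite <- (exp_ln (L2 / beta)) by (apply Rdiv_lt_0_compat; lra).
  apply exp_monotone; replace (L2 / beta) with (1 / beta * L2) by (field; lra); easy. }
assert (Htd : 0 < theta * delta) by (apply Rmult_lt_0_compat; lra).
assert (HeN : L3 / (theta * delta) <= exp (INR N * h)).
{ assert (HN' : INR N >= 1 / h * ln (1 / (theta * delta) * L3)) by lra.
  apply Hscale in HN'.
  rewrite <- (exp_ln (L3 / (theta * delta))) by (apply Rdiv_lt_0_compat; lra).
  apply exp_monotone; replace (L3 / (theta * delta)) with (1 / (theta * delta) * L3) by (field; lra); easy. }
pose proof (Rmult_le_pos _ h (pos_INR M) ltac:(lra)) as HMh.
pose proof (Rmult_le_pos _ h (pos_INR N) ltac:(lra)) as HNh.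
pose proof (right_tail_exponent theta delta t (INR N * h) L3 Hth Hd Ht ltac:(lra) HeN) as HU.
set (U := t * exp (phase 1 (INR N * h))) in *.
assert (HU0 : 0 < U) by (apply Rmult_lt_0_compat; [lra | apply exp_pos]).
assert (Hj : forall n, INR n * h <= INR (n + j) * h).
{ intros n; apply Rmult_le_compat_r; [lra|]; apply le_INR; lia. }
destruct (window_sum_extension (integrand beta t) h M N j Hh) as [Hlo Hhi].
- apply damped_integrand_continuous.
- apply integrand_ge0.
- intros x y Hxy; apply integrand_increasing; try lra.
  apply Rle_trans with (exp (- (INR M * h))); [apply exp_monotone; lra|].
  rewrite exp_Ropp.
  replace (beta / 2) with (/ (2 / beta)) by (field; lra).
  apply Rinv_le_contravar; [apply Rdiv_lt_0_compat; lra|].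
  apply Rle_trans with (L2 / beta); [|easy].
  apply Rmult_le_compat_r; [apply Rlt_le, Rinv_0_lt_compat; lra | easy].
- intros x y Hxy; apply integrand_decreasing; try lra.
  apply Rle_trans with U; [nra|].
  apply Rmult_le_compat_l; [lra|]; apply exp_monotone, phase_monotone; lra.
- rewrite !exp_sum_window_sum; split; [apply Rmult_le_pos; lra|].
  eapply Rle_trans; [apply Rmult_le_compat_l; [lra | exact Hhi]|].
  rewrite Rmult_plus_distr_l; apply Rplus_le_compat.
  + apply left_tail_bound; try lra.
    * specialize (Hj M); lra.
    * apply (Rmult_le_compat_l beta) in HeM; [|lra].
      replace (beta * (L2 / beta)) with L2 in HeM by (field; lra); easy.
  + rewrite RInt_damped_integrand by lra.
    eapply Rle_trans; [apply HC3b; split; [easy|]|].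
    * apply Rmult_le_compat_l; [lra|]; apply exp_monotone, phase_monotone; [lra | apply Hj].
    * apply Rmult_le_compat_l; [apply Rlt_le; now apply Rmult_lt_0_compat|].
      apply exp_monotone; fold U; lra.
Qed.

Theorem theorem5 :
  exists (C1 : R -> R -> R) (C2 : R -> R) (C3 : R -> R -> R),
  forall beta r theta : R,
    0 < beta -> 0 < r < PI / 2 -> 0 < theta < 1 ->
    0 < C1 beta r /\ 0 < C2 beta /\ 0 < C3 beta theta /\
    forall delta : R, 0 < delta <= 1 ->
    exists eps0 : R, 0 < eps0 /\
    forall eps : R, 0 < eps <= eps0 ->
    forall (h : R) (M N : nat),
      0 < h -> (0 < M)%nat -> (0 < N)%nat ->
      1 / h >= 1 / (2 * PI * r) * ln (3 * C1 beta r / eps) ->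
      INR M >= 1 / h * ln (1 / beta * ln (3 * C2 beta / eps)) ->
      INR N >= 1 + 1 / h * ln (1 / (theta * delta) * ln (3 * C3 beta theta / eps)) ->
      forall t : R, delta <= t <= 1 ->
        Rabs (rel_error beta h M N t) <= eps.
Proof.
exists (fun beta r => epsilon (inhabits 1) (discretization_constant_spec beta r)),
  (fun beta => / (beta * Gamma beta)),
  (fun beta theta => epsilon (inhabits 1) (right_tail_constant_spec beta theta)).
intros beta r theta Hb Hr Hth.
destruct (Gamma_is_limit beta Hb) as [HG _].
assert (H1 : discretization_constant_spec beta r
               (epsilon (inhabits 1) (discretization_constant_spec beta r)))
  by (apply epsilon_spec, discretization_constant_exists; trivial).
assert (H3 : right_tail_constant_spec beta theta
               (epsilon (inhabits 1) (right_tail_constant_spec beta theta)))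
  by (apply epsilon_spec, right_tail_constant_exists; trivial).
revert H1 H3; generalize (epsilon (inhabits 1) (discretization_constant_spec beta r)) as C1.
generalize (epsilon (inhabits 1) (right_tail_constant_spec beta theta)) as C3.
intros C3 C1 H1 H3.
(* The value of [C2] turns [exp (- L2) / beta] into [Gamma beta * eps / 3]. *)
set (C2 := / (beta * Gamma beta)).
assert (HC1 : 0 < C1) by apply H1.
assert (HC3 : 0 < C3) by apply H3.
assert (HC2 : 0 < C2) by (apply Rinv_0_lt_compat, Rmult_lt_0_compat; easy).
do 3 (split; [easy|]).
intros delta Hdelta.
(* The three bounds on [eps] give [s <= / 2], [2 <= L2] and [beta + 1 <= L3]. *)
exists (Rmin C1 (Rmin (3 * C2 * exp (- (2))) (3 * C3 * exp (- (beta + 1))))).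
split.
{ repeat apply Rmin_pos; [easy | |]; apply Rmult_lt_0_compat; try apply exp_pos; lra. }
intros eps [He Heps] h M N Hh _ _ Hhh HM HN t Ht.
assert (He1 : eps <= C1) by (eapply Rle_trans; [exact Heps | apply Rmin_l]).
assert (He23 := Rle_trans _ _ _ Heps (Rmin_r _ _)).
assert (He2 : eps <= 3 * C2 * exp (- (2))) by (eapply Rle_trans; [exact He23 | apply Rmin_l]).
assert (He3 : eps <= 3 * C3 * exp (- (beta + 1))) by (eapply Rle_trans; [exact He23 | apply Rmin_r]).
pose proof PI_RGT_0 as HPI.
assert (H2pr : 0 < 2 * PI * r) by (apply Rmult_lt_0_compat; lra).
set (s := exp (- (2 * PI * r / h))).
assert (Hs : s <= eps / (3 * C1)).
{ rewrite <- exp_neg_ln_ratio by lra; apply exp_monotone.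
  apply Rge_le, (Rmult_le_compat_l (2 * PI * r)) in Hhh; [|lra].
  replace (2 * PI * r * (1 / (2 * PI * r) * ln (3 * C1 / eps))) with (ln (3 * C1 / eps)) in Hhh
    by (field; lra).
  replace (2 * PI * r / h) with (2 * PI * r * (1 / h)) by (field; lra); lra. }
assert (Hs2 : s <= / 2).
{ apply Rle_trans with (1 := Hs), (Rle_div_l _ _ (3 * C1)); lra. }
set (T := Rpower t beta).
assert (HT : 0 < T) by apply exp_pos.
set (S := exp_sum beta h M N t).
assert (Hmain : Rabs (T * S - Gamma beta) <= Gamma beta * eps).
{ apply le_epsilon; intros e Hepos.
  destruct (proj2 H1 t h M N e ltac:(lra) Hh Hepos Hs2) as [j Hj].
  assert (HL2 : 2 <= ln (3 * C2 / eps)) by (apply le_ln_ratio; lra).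
  assert (HL3 : beta + 1 <= ln (3 * C3 / eps)) by (apply le_ln_ratio; lra).
  destruct (truncation_error beta theta C3 delta t h M N _ _ j Hb Hth H3 ltac:(lra)
    ltac:(lra) Hh HL2 HL3 HM HN) as [Hlo Hhi].
  rewrite !exp_neg_ln_ratio in Hhi by lra.
  fold T S s in Hj, Hlo, Hhi.
  replace (eps / (3 * C2) / beta) with (Gamma beta * eps / 3) in Hhi by (unfold C2; field; lra).
  replace (Gamma beta * C3 * (eps / (3 * C3))) with (Gamma beta * eps / 3) in Hhi by (field; lra).
  assert (Hs3 : Gamma beta * C1 * s <= Gamma beta * eps / 3).
  { apply Rle_trans with (Gamma beta * C1 * (eps / (3 * C1))).
    - apply Rmult_le_compat_l; [apply Rlt_le; now apply Rmult_lt_0_compat | easy].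
    - right; field; lra. }
  apply Rabs_le_between in Hj; apply Rabs_le; lra. }
unfold rel_error; fold T S.
replace (1 - T / Gamma beta * S) with (- (T * S - Gamma beta) / Gamma beta) by (field; lra).
unfold Rdiv; rewrite Rabs_mult, Rabs_Ropp, (Rabs_pos_eq (/ Gamma beta))
  by (apply Rlt_le, Rinv_0_lt_compat; easy).
apply (Rle_div_l _ _ (Gamma beta)); lra.
Qed.
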